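(* Let $\delta\in\{\mathsf N,\mathsf D,\mathsf U,\mathsf X\}^n$. The following two sets coincide and define a polytope $\mathbb{PT}(\delta)$ (the $\delta$-permutreehedron): (i) the convex hull of the points $\mathbf a(T)\in\mathbb R^n$ for all $\delta$-permutrees $T$; (ii) the intersection of the hyperplane $\mathbb H$ with the half-spaces $\mathbf H^{\ge}(B)$ for all $\delta$-building blocks $B$. Moreover, the $\delta$-permutree fan $\mathcal F(\delta)$ is the (outer) normal fan of $\mathbb{PT}(\delta)$.
   Context: Permutrees. A decoration of size $n$ is a word $\delta=\delta_1\cdots\delta_n$ in the symbols $\mathsf N$ (none), $\mathsf D$ (down), $\mathsf U$ (up), $\mathsf X$ (both). A permutree is a directed tree $T$ with $n$ vertices labeled bijectively by $[n]=\{1,\dots,n\}$ (vertices are identified with labels) in which each vertex has one or two parents (outgoing neighbors) and one or two children (incoming neighbors); a parent or child may be an unlabeled leaf (dangling edge), so ancestor and descendant subtrees may be empty. The ancestor (resp. descendant) subtree of $i$ through a given parent (resp. child) is the whole connected component, reached through it, of the tree with $i$ removed; its size is its number of labeled vertices. If $i$ has two parents (resp. children), they are distinguished as left and right, and all labels in the left ancestor (resp. descendant) subtree of $i$ are smaller than $i$ while all labels in the right one are larger than $i$. The decoration of $T$ is given by $\delta(T)_i=\mathsf N,\mathsf D,\mathsf U,\mathsf X$ according to whether $i$ has (one parent, one child), (one parent, two children), (two parents, one child), (two parents, two children). A $\delta$-permutree is a permutree with decoration $\delta$. An edge cut of $T$ is an ordered partition $(I\,\|\,J)$ of $[n]$ where,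 for some edge of $T$ between two labeled vertices, $I$ is the set of labels on the source side and $J=[n]\setminus I$ the set of labels on the target side of this edge. A $\delta$-building block is a subset $I\subset[n]$ such that $(I\,\|\,[n]\setminus I)$ is an edge cut of some $\delta$-permutree. Points. For a $\delta$-permutree $T$, $\mathbf a(T)\in\mathbb R^n$ has coordinates $\mathbf a(T)_i = 1+d$ if $\delta_i=\mathsf N$; $1+d+\underline\ell\,\underline r$ if $\delta_i=\mathsf D$; $1+d-\overline\ell\,\overline r$ if $\delta_i=\mathsf U$; $1+d+\underline\ell\,\underline r-\overline\ell\,\overline r$ if $\delta_i=\mathsf X$. Here $d$ is the total size of the descendant subtree(s) of $i$, $\underline\ell,\underline r$ are the sizes of the left and right descendant subtrees of $i$ (when $\delta_i\in\{\mathsf D,\mathsf X\}$), and $\overline\ell,\overline r$ are the sizes of the left and right ancestor subtrees of $i$ (when $\delta_i\in\{\mathsf U,\mathsf X\}$). Hyperplanes. $\mathbb H=\{x\in\mathbb R^n:\sum_{i\in[n]}x_i=\binom{n+1}{2}\}$ and $\mathbf H^{\ge}(J)=\{x\in\mathbb R^n:\sum_{j\in J}x_j\ge\binom{|J|+1}{2}\}$. Fan. The $\delta$-permutree fan $\mathcal F(\delta)$ is the complete simplicial fan of $\mathbb H$ (with $\frac{n+1}{2}(1,\dots,1)$ taken as origin) consisting of the cones $\mathrm C^\diamond(T)=\{x\in\mathbb H: x_i\le x_j \text{ for every edge } i\to j \text{ of } T\}$, for all $\delta$-permutrees $T$, together with all their faces. The outer normal cone of a face $F$ of a polytope is the cone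 generated by the outer normal vectors of the facets containing $F$ (here taken within $\mathbb H$, with the point $\frac{n+1}{2}(1,\dots,1)$ as origin), and the normal fan is the collection of normal cones of all faces. *)

(* Defs.v *)
(* MathComp, with MathComp-Analysis for classical sets and the real numbers. *)
From mathcomp Require Import all_boot all_order all_algebra.
From mathcomp Require Import boolp classical_sets cardinality reals.

Set Implicit Arguments.
Unset Strict Implicit.
Unset Printing Implicit Defensive.

Import Order.TTheory GRing.Theory Num.Theory.

Local Open Scope nat_scope.

(* The labels 1, ..., n are represented by 'I_n = {0, ..., n-1}: only their
   order and their number matter. *)

Inductive symbol := symbN | symbD | symbU | symbX.

(* The neighbors of a vertex on one side (its parents, or its children): a
   single one, or a left one and a right one. *)
Inductive slots (A : Type) := One of A | Two of A & A.

Definition slots_seq (A : Type) (s : slots A) : seq A :=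
  match s with One a => [:: a] | Two l r => [:: l; r] end.

Coercion slots_seq : slots >-> seq.

Section DirectedTrees.
Variables (V : finType) (e : rel V).

Definition undirected : rel V := [rel x y | e x y || e y x].

(* The first condition excludes loops and pairs of opposite edges, which the
   symmetrized relation in the other two conditions does not see. *)
Definition directed_tree : Prop :=
  [/\ forall x y, e x y -> ~~ e y x,
      forall x y, connect undirected x y &
      forall c : seq V, 2 < size c -> ~ ucycle undirected c].

Definition subtree_through (i j : V) : {set V} :=
  [set k | connect [rel x y | [&& x != i, y != i & undirected x y]] j k]%SET.

(* The labels on the source side of an edge i -> j. *)
Definition source_side (i j : V) : {set V} :=
  [set k | connect [rel x y | undirected x y &&
     ~~ ((x == i) && (y == j) || (x == j) && (y == i))] i k]%SET.

End DirectedTrees.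

Section Presentation.
Variables (n : nat) (parents children : 'I_n -> slots (option 'I_n)).

Definition slot_edge : rel 'I_n := [rel i j | Some j \in (parents i : seq _)].

(* None stands for an unlabeled leaf. *)
Definition slot_subtree (i : 'I_n) (o : option 'I_n) : {set 'I_n} :=
  if o is Some j then subtree_through slot_edge i j else finset.set0.

Definition ordered_at (i : 'I_n) (s : slots (option 'I_n)) : Prop :=
  match s with
  | One _ => True
  | Two l r => (forall k : 'I_n, k \in slot_subtree i l -> k < i) /\
               (forall k : 'I_n, k \in slot_subtree i r -> i < k)
  end.

End Presentation.

Record permutree (n : nat) := Permutree {
  parents : 'I_n -> slots (option 'I_n);
  children : 'I_n -> slots (option 'I_n);
  childrenE : forall i j : 'I_n,
    (Some j \in (parents i : seq _)) = (Some i \in (children j : seq _));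
  permutree_tree : directed_tree (slot_edge parents);
  parents_ordered : forall i, ordered_at parents i (parents i);
  children_ordered : forall i, ordered_at parents i (children i)
}.

Section Permutrees.
Variables (n : nat) (T : permutree n).

Definition edge : rel 'I_n := slot_edge (parents T).

Definition subtree_size (i : 'I_n) (o : option 'I_n) : nat :=
  #|slot_subtree (parents T) i o|.

Definition descendants (i : 'I_n) : nat :=
  \sum_(o <- children T i) subtree_size i o.

Definition symbol_at (i : 'I_n) : symbol :=
  match parents T i, children T i with
  | One _, One _ => symbN
  | One _, Two _ _ => symbD
  | Two _ _, One _ => symbU
  | Two _ _, Two _ _ => symbX
  end.

Definition decoration : n.-tuple symbol := [tuple symbol_at i | i < n].

End Permutrees.

Definition building_block (n : nat) (delta : n.-tuple symbol)
    (B : {set 'I_n}) : Prop :=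
  exists T : permutree n, decoration T = delta /\
    exists i j : 'I_n, edge T i j /\ B = source_side (edge T) i j.

Local Open Scope classical_set_scope.
Local Open Scope ring_scope.

Section Polyhedra.
Variables (R : realType) (n : nat).
Implicit Types (A P F C : set 'rV[R]_n) (x y c v : 'rV[R]_n).

Definition dotp x y : R := \sum_(i < n) x 0 i * y 0 i.

Definition convex_hull A : set 'rV[R]_n :=
  [set x | exists (m : nat) (p : 'I_m -> 'rV[R]_n) (w : 'I_m -> R),
     [/\ forall k, A (p k), forall k, 0 <= w k, \sum_(k < m) w k = 1 &
         x = \sum_(k < m) w k *: p k]].

Definition conic_hull A : set 'rV[R]_n :=
  [set x | exists (m : nat) (p : 'I_m -> 'rV[R]_n) (w : 'I_m -> R),
     [/\ forall k, A (p k), forall k, 0 <= w k &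
         x = \sum_(k < m) w k *: p k]].

Definition polytope P : Prop :=
  exists2 A, finite_set A & P = convex_hull A.

Definition maximizers P c : set 'rV[R]_n :=
  [set x | P x /\ forall y, P y -> dotp c y <= dotp c x].

(* Only nonempty faces; P itself is one (take c = 0). *)
Definition face P F : Prop :=
  F !=set0 /\ exists c, F = maximizers P c.

(* The affine hull of P has dimension d: P contains d + 1 affinely independent
   points and lies in their affine span. *)
Definition has_dim P (d : nat) : Prop :=
  exists (p0 : 'rV[R]_n) (D : 'M[R]_(d, n)),
    [/\ P p0, forall k : 'I_d, P (p0 + row k D), row_free D &
        forall x, P x -> (x - p0 <= D)%MS].

Definition facet P F : Prop :=
  face P F /\ exists d : nat, has_dim P d.+1 /\ has_dim F d.

Definition perm_hyperplane : set 'rV[R]_n :=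
  [set x : 'rV[R]_n | \sum_(i < n) x 0 i = 'C(n.+1, 2)%:R].

Definition perm_halfspace (J : {set 'I_n}) : set 'rV[R]_n :=
  [set x : 'rV[R]_n | 'C(#|J|.+1, 2)%:R <= \sum_(j in J) x 0 j].

Definition perm_center : 'rV[R]_n := const_mx (n.+1%:R / 2).

(* Outer normals within perm_hyperplane: v is a direction of the hyperplane. *)
Definition outer_normal P F v : Prop :=
  \sum_(i < n) v 0 i = 0 /\ F = maximizers P v.

(* A cone of perm_hyperplane with apex perm_center. *)
Definition normal_cone P F : set 'rV[R]_n :=
  [set perm_center + u | u in
     conic_hull [set v | exists G, [/\ facet P G, F `<=` G & outer_normal P G v]]].

Definition normal_fan P : set (set 'rV[R]_n) :=
  [set C | exists2 F, face P F & C = normal_cone P F].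

End Polyhedra.

Section Permutreehedra.
Variables (R : realType) (n : nat).

Definition permutree_point (T : permutree n) : 'rV[R]_n :=
  \row_(i < n)
    let d : R := (descendants T i)%:R in
    let s o : R := (subtree_size T i o)%:R in
    match parents T i, children T i with
    | One _, One _ => 1 + d
    | One _, Two l r => 1 + d + s l * s r
    | Two l r, One _ => 1 + d - s l * s r
    | Two l r, Two l' r' => 1 + d + s l' * s r' - s l * s r
    end.

Definition permutree_hull (delta : n.-tuple symbol) : set 'rV[R]_n :=
  convex_hull [set permutree_point T | T in [set T | decoration T = delta]].

Definition permutree_polyhedron (delta : n.-tuple symbol) : set 'rV[R]_n :=
  @perm_hyperplane R n `&`
  \bigcap_(B in [set B | building_block delta B]) perm_halfspace B.

Definition permutree_cone (T : permutree n) : set 'rV[R]_n :=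
  [set x : 'rV[R]_n | perm_hyperplane x /\ forall i j, edge T i j -> x 0 i <= x 0 j].

(* The faces of a cone include the cone itself. *)
Definition permutree_fan (delta : n.-tuple symbol) : set (set 'rV[R]_n) :=
  [set C | exists2 T, decoration T = delta & face (permutree_cone T) C].

End Permutreehedra.

Arguments permutree_hull R {n} delta.
Arguments permutree_polyhedron R {n} delta.
Arguments permutree_fan R {n} delta.

(* Main.v *)
Require Import Defs.
From mathcomp Require Import all_boot all_order all_algebra.
From mathcomp Require Import boolp classical_sets cardinality reals.
From mathcomp Require Import zify ring lra.

(* Write B_e for the source side of an edge e = (i -> j) of T, and u_e = e_j - e_i.
   One has a(T) = (n+1)/2 1 + 1/2 sum_e |B_e| (n - |B_e|) u_e, where
   |B_e| (n - |B_e|) counts the pairs of vertices separated by e. Hence, for any I,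
     sum_(i in I) a(T)_i - C(|I|+1, 2)
   is half the sum over unordered pairs {a, c} of [I separates a, c] minus the
   signed number of edges on the path from a to c that cross the boundary of I
   (+1 if the edge leaves I upwards, -1 if it enters I upwards). If I is a
   building block, two consecutive crossings cannot both be positive: between
   them the path would have a peak, or a valley, at a vertex b whose wall
   separates two labels a < b < c in a way no edge cut of a delta-permutree
   allows. So every term is nonnegative, and all vanish only if I is an edge cut
   of T: a(T) lies in the polyhedron, and the inequalities tight at a(T) are
   those of the edges of T.

   Every linear order on the labels is a linear extension of some
   delta-permutree, so the cones of the permutrees cover the space. With Farkas'
   lemma this gives (i) = (ii). As the tight inequalities at a(T) are linearly
   independent and all others have integral slack, a(T) - u_e stays in the
   polyhedron for each edge e; this determines the normal cones. *)

Set Implicit Arguments.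
Unset Strict Implicit.
Unset Printing Implicit Defensive.

Import Order.TTheory GRing.Theory Num.Theory.

(** * Subtrees and paths in a directed tree *)

Lemma connect_invariant (V : finType) (r : rel V) (A : pred V) :
  (forall x y, r x y -> A x -> A y) ->
  forall x y, connect r x y -> A x -> A y.
Proof.
move=> rA x y /connectP [p]; elim: p x => [|z p IHp] x /= => [_ -> //|].
by case/andP=> rxz pathp lastp Ax; apply: (IHp z) => //; apply: rA Ax.
Qed.

Section TreeLemmas.
Variables (V : finType) (e : rel V).
Hypothesis treeV : directed_tree e.
Local Notation und := (undirected e).
Local Notation B := (subtree_through e).

Lemma undC x y : und x y = und y x.
Proof. by rewrite /undirected /= orbC. Qed.

Lemma und_neq x y : und x y -> x != y.
Proof.
case: treeV => asym _ _; apply: contraTneq => <-; rewrite /undirected /= orbb.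
by apply/negP => exx; move/negP: (asym _ _ exx).
Qed.

Lemma edge_und x y : e x y -> und x y.
Proof. by rewrite /undirected /= => ->. Qed.

Lemma edge_und' x y : e y x -> und x y.
Proof. by rewrite /undirected /= => ->; rewrite orbT. Qed.

Lemma mem_subtree_root i j : j \in B i j.
Proof. by rewrite inE connect0. Qed.

Lemma mem_subtreeC i j k : (k \in B i j) = (j \in B i k).
Proof.
rewrite !inE sym_connect_sym // => x y.
by apply/idP/idP=> /and3P [? ?]; rewrite undC=> ?; apply/and3P.
Qed.

Lemma mem_subtree_trans i j k l : k \in B i j -> l \in B i k -> l \in B i j.
Proof. by rewrite !inE; apply: connect_trans. Qed.

Lemma notin_subtree i j k : i != j -> k \in B i j -> k != i.
Proof.
rewrite inE => neq_ij conn.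
apply: (connect_invariant (A := fun k => k != i) _ conn).
  by move=> x y /and3P [].
by rewrite eq_sym.
Qed.

Lemma subtree_self i j : i != j -> i \notin B i j.
Proof. by move=> neq_ij; apply/negP=> /(notin_subtree neq_ij); rewrite eqxx. Qed.

Lemma subtree_step i j x y : i != j ->
  x \in B i j -> und x y -> y != i -> y \in B i j.
Proof.
move=> neq_ij xB uxy y_i; have x_i := notin_subtree neq_ij xB.
move: xB; rewrite !inE => conn; apply: connect_trans conn (connect1 _).
by apply/and3P.
Qed.

Lemma subtree_path i j p : path und j p -> i \notin j :: p ->
  {subset j :: p <= B i j}.
Proof.
move=> pathp; rewrite inE negb_or => /andP [neq_ij ip].
elim/last_ind: p pathp ip => [|p z IHp].
  by move=> _ _ z; rewrite inE => /eqP ->; apply: mem_subtree_root.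
rewrite rcons_path mem_rcons inE negb_or => /andP [pathp uz] /andP [iz ip].
move=> w; rewrite -rcons_cons mem_rcons inE => /orP [/eqP ->|]; last exact: IHp.
apply: subtree_step uz _ => //; last by rewrite eq_sym.
by apply: IHp => //; apply: mem_last.
Qed.

Lemma uniq_path_of_connect (r : rel V) x y : connect r x y ->
  exists p, [/\ path r x p, uniq (x :: p) & last x p = y].
Proof.
case/connectP=> p pathp ->; case: (shortenP pathp) => q pathq uniq_q _.
by exists q.
Qed.

Lemma avoiding_path i j k : i != j -> k \in B i j ->
  exists p, [/\ path und j p, uniq (j :: p), last j p = k & i \notin j :: p].
Proof.
rewrite inE => neq_ij /uniq_path_of_connect [p [pathp uniq_p lastp]].
exists p; split=> //; first by apply: sub_path pathp => x y /and3P [].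
rewrite inE negb_or neq_ij /=.
elim: p j {uniq_p lastp neq_ij} pathp => //= z p IHp j /andP [/and3P [_ zi _] pathp].
by rewrite inE negb_or eq_sym zi; apply: IHp pathp.
Qed.

(** The component [B i j] could only be left by stepping back to [i]. A simple path from [j] to [u]
    avoiding [i] would then close into a cycle through [i], of length at least three because [u] is
    not [j]. *)
Lemma subtree_adj_sub i j u v : und i j -> und u v ->
  ~~ ((u == i) && (v == j) || (u == j) && (v == i)) ->
  u \in B i j -> v \in B i j.
Proof.
move=> uij uuv nuv uB; have neq_ij := und_neq uij.
have [v_i|/(subtree_step neq_ij uB uuv) //] := eqVneq v i.
subst v; have [p [pathp uniq_p lastp ip]] := avoiding_path neq_ij uB.
have [_ _ /(_ (i :: j :: p))] := treeV; case=> //.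
  case: p lastp {pathp uniq_p ip} => //= eq_uj; subst u.
  by rewrite !eqxx orbT in nuv.
apply/andP; split; last by rewrite cons_uniq ip.
by rewrite (cycle_path i) /= lastp uuv uij.
Qed.

Lemma subtree_adj i j u v : und i j -> und u v ->
  ~~ ((u == i) && (v == j) || (u == j) && (v == i)) ->
  (u \in B i j) = (v \in B i j).
Proof.
move=> uij uuv nuv; apply/idP/idP; apply: subtree_adj_sub => //.
  by rewrite undC.
by apply: contra nuv => /orP [] /andP [-> ->]; rewrite ?orbT.
Qed.

Lemma subtree_compl i j : und i j -> B j i = ~: B i j.
Proof.
move=> uij; have uji : und j i by rewrite undC.
have neq_ij := und_neq uij; have neq_ji := und_neq uji.
apply/setP => k; rewrite [in RHS]inE; apply/idP/idP; rewrite [k \in B j i]inE.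
  move=> conn; apply: (connect_invariant (A := fun k => k \notin B i j) _ conn).
    move=> x y /and3P [xj yj uxy]; rewrite (subtree_adj uij uxy) //.
    by rewrite (negPf xj) (negPf yj) andbF.
  exact: subtree_self.
move=> kB; suff: (k \in B j i) || (k \in B i j) by rewrite (negPf kB) orbF inE.
have [_ conn _] := treeV.
apply: (connect_invariant (A := fun k => (k \in B j i) || (k \in B i j))
  _ (conn i k)); last by rewrite mem_subtree_root.
move=> x y uxy; have [|nxy] :=
  boolP ((x == i) && (y == j) || (x == j) && (y == i)).
  by case/orP=> /andP [_ /eqP ->]; rewrite mem_subtree_root ?orbT.
rewrite (subtree_adj uij uxy) // (subtree_adj uji uxy) //.
by apply: contra nxy => /orP [] /andP [-> ->]; rewrite ?orbT.
Qed.

(** Deleting the edge and deleting its upper end leave the same component of the lower end. From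
    here on, edge cuts are written as [B j i]. *)
Lemma source_sideE i j : e i j -> source_side e i j = B j i.
Proof.
move=> eij; have uji := edge_und' eij.
apply/setP => k; rewrite inE; apply/idP/idP.
  move=> conn; apply: (connect_invariant (A := fun k => k \in B j i) _ conn).
    move=> x y /andP [uxy nxy]; rewrite (subtree_adj uji uxy) //.
    by rewrite orbC.
  exact: mem_subtree_root.
rewrite inE; apply: connect_sub => x y /and3P [xj yj uxy]; apply: connect1.
by rewrite /= uxy (negPf xj) (negPf yj) andbF.
Qed.

(** [B j i] is connected, avoids [b] and meets [B b v], so it stays in that component. *)
Lemma subtree_sub i j b v : j != i -> b != v -> b \notin B j i -> i \in B b v ->
  {subset B j i <= B b v}.
Proof.
move=> neq_ji neq_bv bB iB k; rewrite [k \in B j i]inE => conn.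
suff: (k \in B j i) && (k \in B b v) by case/andP.
apply: (connect_invariant (A := fun k => (k \in B j i) && (k \in B b v)) _ conn).
  move=> x y /and3P [xj yj uxy] /andP [xB xBb].
  have yB : y \in B j i by apply: subtree_step uxy yj.
  rewrite yB; apply: subtree_step uxy _ => //.
  by apply: contraNneq bB => <-.
by rewrite iB mem_subtree_root.
Qed.

Lemma subtree_disjoint i j j' k : und i j -> und i j' ->
  k \in B i j -> k \in B i j' -> j = j'.
Proof.
move=> uij uij' kB kB'; apply/eqP/negPn/negP => neq_jj'.
have : j \in B i j'.
  by apply: mem_subtree_trans kB' _; rewrite mem_subtreeC.
rewrite -(subtree_adj uij' uij) ?eqxx ?(negPf neq_jj') /=.
  by rewrite (negPf (subtree_self (und_neq uij'))).
by rewrite (negPf (und_neq uij')).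
Qed.

Lemma subtree_cover i k : k != i -> exists2 j, und i j & k \in B i j.
Proof.
move=> ki; have [_ conn _] := treeV.
suff: (k == i) || [exists j, und i j && (k \in B i j)].
  by rewrite (negPf ki) => /existsP [j /andP [uij kB]]; exists j.
apply: (connect_invariant
  (A := fun k => (k == i) || [exists j, und i j && (k \in B i j)])
  _ (conn i k)); last by rewrite eqxx.
move=> x y uxy; have [->|yi] := eqVneq y i => //=.
case/orP=> [/eqP xi|/existsP [j /andP [uij xB]]]; apply/existsP.
  by exists y; rewrite mem_subtree_root -xi uxy.
by exists j; rewrite uij; apply: subtree_step uxy yi => //; apply: und_neq.
Qed.

(** The turn [q] is the first vertex at which the path starts to descend. The parts before and after
    it avoid [q], hence stay in the subtrees through [x] and [y]. *)
Lemma peak_on_path u v p w : uniq (u :: rcons (v :: p) w) ->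
  path und u (rcons (v :: p) w) -> e u v -> e w (last v p) ->
  exists q x y, [/\ q \in v :: p, e x q, e y q, x != y &
    u \in B q x /\ w \in B q y].
Proof.
elim: p u v => [|v' p IHp] u v; rewrite ?rcons_cons.
  move=> /= /and3P [uN _ _] _ euv ewv; exists v, u, w.
  rewrite !mem_subtree_root inE eqxx; split=> //.
  by apply: contraNneq uN => ->; rewrite !inE eqxx orbT.
rewrite cons_uniq => /andP [uN uniq_vp] pathp.
have {pathp} [uuv pathp] : und u v /\ path und v (rcons (v' :: p) w).
  exact/andP.
move=> euv ew.
have [ev'v|ne] := boolP (e v' v).
  exists v, u, v'; rewrite mem_subtree_root inE eqxx; split=> //.
    by apply: contraNneq uN => ->; rewrite !inE eqxx !orbT.
  split=> //; apply: (@subtree_path _ _ (rcons p w)).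
  - by move: pathp => /andP [].
  - by move: uniq_vp; rewrite cons_uniq => /andP [].
  - by rewrite inE mem_rcons mem_head orbT.
have evv' : e v v' by move: pathp => /andP [/orP [//|]]; rewrite (negPf ne).
have [q [x [y [qp exq eyq xy [vB wB]]]]] := IHp v v' uniq_vp pathp evv' ew.
exists q, x, y; split=> //; first by rewrite inE qp orbT.
split=> //; apply: subtree_step vB _ _.
- by rewrite und_neq // edge_und'.
- by rewrite undC.
apply: contraNneq uN => ->; move: qp; rewrite !inE mem_rcons inE.
by case/orP=> ->; rewrite ?orbT.
Qed.

End TreeLemmas.

(** * Insertion: every linear order extends some permutree *)

Definition has_down (a : symbol) : bool :=
  match a with symbD | symbX => true | _ => false end.

Definition has_up (a : symbol) : bool :=
  match a with symbU | symbX => true | _ => false end.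

(** A cycle through an edge would have to cross the cut of this edge a second time, and no other
    edge crosses it. *)
Lemma acyclic_of_cuts (V : finType) (e : rel V) :
  (forall x y, e x y -> exists I : {set V}, [/\ x \in I, y \notin I &
     forall u v, e u v -> (u \in I) != (v \in I) -> u = x /\ v = y]) ->
  forall c : seq V, 2 < size c -> ~ ucycle (undirected e) c.
Proof.
move=> cuts [|x [|y [|z p]]] //= _ /andP [cyc uniq_c].
have [uxy pathp] : undirected e x y /\ path (undirected e) y (rcons (z :: p) x).
  exact/andP.
have {cyc uniq_c} [xN yN] : x \notin y :: z :: p /\ y \notin z :: p.
  by move: uniq_c; rewrite /= => /and3P [].
have [I [neqI cutI]] : exists I : {set V}, (x \in I) != (y \in I) /\
    forall u v, undirected e u v -> (u \in I) != (v \in I) ->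
    (u = x /\ v = y) \/ (u = y /\ v = x).
  case/orP: uxy => [/cuts|/cuts] [I [xI yI cutI]]; exists I;
    rewrite (negPf yI) xI; split=> // u v.
    by case/orP => euv; [move/(cutI _ _ euv)|rewrite eq_sym => /(cutI _ _ euv)];
      move=> [-> ->]; [left|right].
  by case/orP => euv; [move/(cutI _ _ euv)|rewrite eq_sym => /(cutI _ _ euv)];
      move=> [-> ->]; [right|left].
have step u v : undirected e u v -> [|| u \notin [:: x; y] | v \notin [:: x; y]] ->
    (u \in I) = (v \in I).
  move=> uuv nuv; apply/eqP/negPn/negP => /(cutI _ _ uuv) [] [eu ev];
    by move: nuv; rewrite eu ev !inE !eqxx ?orbT.
have pN w : w \in z :: p -> w \notin [:: x; y].
  move=> wp; rewrite !inE negb_or; apply/andP; split.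
    by apply: contraNneq xN => <-; rewrite inE wp orbT.
  by apply: contraNneq yN => <-.
suff : (y \in I) = (x \in I) by move=> eqI; rewrite eqI eqxx in neqI.
have [/= uyz pathz] : undirected e y z /\ path (undirected e) z (rcons p x).
  exact/andP.
rewrite (step y z) ?(pN z) ?mem_head ?orbT //.
elim: p z pathz pN {pathp xN yN uyz} => [|z' p IHp] z /= pathz pN.
  by move: pathz; rewrite andbT => uzx; apply: (step _ _ uzx); rewrite (pN z) ?mem_head.
case/andP: pathz => uzz' pathp.
rewrite (step z z') ?(pN z) ?mem_head //; apply: IHp => // w wp.
by apply: pN; rewrite inE wp orbT.
Qed.

Section Insertion.
Variables (n : nat) (delta : n.-tuple symbol) (s : 'I_n -> nat).
Hypothesis s_inj : injective s.
Local Notation dn b := (has_down (tnth delta b)).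
Local Notation up b := (has_up (tnth delta b)).

(* A vertex with two children (two parents) has a vertical wall below (above)
   it; the height of a vertex b is [s b]. *)
Definition blocks (b k : 'I_n) : bool :=
  (up b && (s b < s k)) || (dn b && (s k < s b)).

(* The column [c], from 0 to n, lies between the labels c - 1 and c. *)
Definition strictly_between (c : nat) (b k : 'I_n) : bool :=
  (k < b < c) || (c <= b < k).

(** With the label [k] drawn at abscissa [k] and height [s k], this is horizontal visibility of [k]
    from the column [c]. *)
Definition hits (c : nat) (k : 'I_n) : bool :=
  [forall b : 'I_n, strictly_between c b k ==> ~~ blocks b k].

(** The future edges: in each column, a strand joins every visible label to the next visible one
    above it. *)
Definition consecutive (c : nat) (i j : 'I_n) : bool :=
  [&& hits c i, hits c j, s i < s j &
    [forall k, hits c k ==> ~~ (s i < s k < s j)]].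

(** These walls span all heights from [i] to [j], so a strand between the two cannot be slid across
    them. *)
Definition wall (i j b : 'I_n) : bool :=
  (up b && (s b <= s i)) || (dn b && (s j <= s b)).

Lemma hits_left (k : 'I_n) : hits k k.
Proof. by apply/forallP=> b; apply/implyP; rewrite /strictly_between; lia. Qed.

Lemma hits_right (k : 'I_n) : hits k.+1 k.
Proof. by apply/forallP=> b; apply/implyP; rewrite /strictly_between; lia. Qed.

Lemma hitsP c k b : hits c k -> strictly_between c b k -> ~~ blocks b k.
Proof. by move/forallP/(_ b)/implyP. Qed.

Lemma hits_step (b k : 'I_n) : ~~ blocks b k -> hits b k = hits b.+1 k.
Proof.
move=> nb; apply: eq_forallb => b'; have [->|ne] := eqVneq b' b.
  by rewrite nb !implybT.
have {}ne : nat_of_ord b' != b by [].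
by congr (_ ==> _); rewrite /strictly_between; lia.
Qed.

(** The label [b] is visible from both columns bordering it. If its height lies strictly between
    those of [i] and [j], it breaks the strand in both columns; otherwise its walls miss all heights
    of the strand and both columns see the same labels there. *)
Lemma consecutive_step (b i j : 'I_n) : ~~ wall i j b ->
  consecutive b i j = consecutive b.+1 i j.
Proof.
move=> nw; have [sij|sji] := ltnP (s i) (s j); last first.
  by rewrite /consecutive ltnNge sji /= !andbF.
have [sb|nsb] := boolP (s i < s b < s j).
  rewrite /consecutive; apply/idP/idP => /and4P [_ _ _ /forallP /(_ b)];
    by rewrite sb ?hits_left ?hits_right.
have eq_hits k : s i <= s k <= s j -> hits b k = hits b.+1 k.
  move=> sk; apply: hits_step; move: nw nsb sk; rewrite /wall /blocks.
  by case: (up b); case: (dn b) => /=; lia.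
rewrite /consecutive !eq_hits ?leqnn ?(ltnW sij) //.
congr [&& _, _, _ & _]; apply: eq_forallb => k.
have [sk|] := boolP (s i < s k < s j); last by rewrite !implybT.
by rewrite eq_hits //; lia.
Qed.

Lemma consecutive_move c c' i j : c <= n -> c' <= n ->
  (forall b : 'I_n, (c <= b < c') || (c' <= b < c) -> ~~ wall i j b) ->
  consecutive c i j = consecutive c' i j.
Proof.
wlog le_cc' : c c' / c <= c'.
  move=> wlog_le cn c'n nw; have [le_cc'|/ltnW le_c'c] := leqP c c'.
    exact: wlog_le.
  by apply/esym/wlog_le => // b; rewrite orbC; apply: nw.
move=> _ c'n; have ->: c' = (c' - c) + c by lia.
have: (c' - c) + c <= n by lia.
elim: (c' - c) => [//|m IHm] mn nw.
rewrite IHm; first last.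
- by move=> b hb; apply: nw; lia.
- by lia.
have lt_mn : m + c < n by lia.
by apply: (@consecutive_step (Ordinal lt_mn)); apply: nw => /=; lia.
Qed.

Lemma hits_source_wall c i j b : hits c i -> s i < s j ->
  strictly_between c b i -> ~~ wall i j b.
Proof.
move=> hi sij bi; have := hitsP hi bi; rewrite /blocks /wall.
have: b != i by apply: contraTneq bi => ->; rewrite /strictly_between; lia.
rewrite -(inj_eq s_inj); case: (up b); case: (dn b) => /=; lia.
Qed.

Lemma hits_target_wall c i j b : hits c j -> s i < s j ->
  strictly_between c b j -> ~~ wall i j b.
Proof.
move=> hj sij bj; have := hitsP hj bj; rewrite /blocks /wall.
have: b != j by apply: contraTneq bj => ->; rewrite /strictly_between; lia.
rewrite -(inj_eq s_inj); case: (up b); case: (dn b) => /=; lia.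
Qed.

(** Sliding the strand towards its lower end [i] meets no wall, since such a wall would hide [i]. It
    arrives in the column bordering [i] on the side of [c]: column [i] on the left, column [i.+1] on
    the right. *)
Lemma consecutive_at_source c i j : c <= n -> consecutive c i j ->
  consecutive (if c <= i then i : nat else i.+1) i j.
Proof.
move=> cn cons; have /and4P [hi _ sij _] := cons; have lt_in := ltn_ord i.
rewrite -(@consecutive_move c) //; first by case: ifP => _; lia.
move=> b hb; apply: (hits_source_wall hi sij); move: hb.
by rewrite /strictly_between; case: ifP; lia.
Qed.

Lemma consecutive_at_target c i j : c <= n -> consecutive c i j ->
  consecutive (if c <= j then j : nat else j.+1) i j.
Proof.
move=> cn cons; have /and4P [_ hj sij _] := cons; have lt_jn := ltn_ord j.
rewrite -(@consecutive_move c) //; first by case: ifP => _; lia.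
move=> b hb; apply: (hits_target_wall hj sij); move: hb.
by rewrite /strictly_between; case: ifP; lia.
Qed.

Lemma consecutive_inj_source c i i' j :
  consecutive c i j -> consecutive c i' j -> i = i'.
Proof.
case/and4P=> hi _ sij /forallP betw /and4P [hi' _ si'j /forallP betw'].
by apply: s_inj; move: (betw i') (betw' i); rewrite hi hi'; lia.
Qed.

Lemma consecutive_inj_target c i j j' :
  consecutive c i j -> consecutive c i j' -> j = j'.
Proof.
case/and4P=> _ hi sij /forallP betw /and4P [_ hi' si'j /forallP betw'].
by apply: s_inj; move: (betw j') (betw' j); rewrite hi hi'; lia.
Qed.

Definition below (c : nat) (j : 'I_n) := [pick i | consecutive c i j].
Definition above (c : nat) (i : 'I_n) := [pick j | consecutive c i j].

Lemma belowP c i j : (Some i == below c j) = consecutive c i j.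
Proof.
rewrite /below; case: pickP => [i' cons'|->] //.
apply/eqP/idP => [[->] //|cons]; congr Some.
exact: consecutive_inj_source cons'.
Qed.

Lemma aboveP c i j : (Some j == above c i) = consecutive c i j.
Proof.
rewrite /above; case: pickP => [j' cons'|->] //.
apply/eqP/idP => [[->] //|cons]; congr Some.
exact: consecutive_inj_target cons'.
Qed.

(** Without a wall above [i], its two bordering columns see the same strand starting at [i], so one
    of them is enough. *)
Definition ins_parents (i : 'I_n) : slots (option 'I_n) :=
  if up i then Two (above i i) (above i.+1 i) else One (above i i).

Definition ins_children (j : 'I_n) : slots (option 'I_n) :=
  if dn j then Two (below j j) (below j.+1 j) else One (below j j).

(** Here and for children, the edges turn out to be the strands of all columns; this is what makes
    the two neighbor functions agree. *)
Lemma ins_parentsP i j : reflect (exists2 c, c <= n & consecutive c i j)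
  (Some j \in (ins_parents i : seq _)).
Proof.
apply: (iffP idP) => [|[c cn cons]].
  rewrite /ins_parents; case: ifP => _; rewrite !inE !aboveP; last first.
    by move=> cons; exists i => //; apply: ltnW.
  by case/orP=> cons; [exists i => //; apply: ltnW|exists i.+1].
have /and4P [_ _ sij _] := cons.
have := consecutive_at_source cn cons; rewrite /ins_parents.
case: (boolP (up i)) => upi; rewrite !inE !aboveP; first by case: ifP => _ ->; rewrite ?orbT.
by case: ifP => _ //; rewrite -consecutive_step // /wall (negPf upi) /= leqNgt sij andbF.
Qed.

Lemma ins_childrenP i j : reflect (exists2 c, c <= n & consecutive c i j)
  (Some i \in (ins_children j : seq _)).
Proof.
apply: (iffP idP) => [|[c cn cons]].
  rewrite /ins_children; case: ifP => _; rewrite !inE !belowP; last first.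
    by move=> cons; exists j => //; apply: ltnW.
  by case/orP=> cons; [exists j => //; apply: ltnW|exists j.+1].
have /and4P [_ _ sij _] := cons.
have := consecutive_at_target cn cons; rewrite /ins_children.
case: (boolP (dn j)) => dnj; rewrite !inE !belowP; first by case: ifP => _ ->; rewrite ?orbT.
by case: ifP => _ //; rewrite -consecutive_step // /wall (negPf dnj) /= leqNgt sij andbF.
Qed.

Lemma ins_childrenE i j :
  (Some j \in (ins_parents i : seq _)) = (Some i \in (ins_children j : seq _)).
Proof. by apply/ins_parentsP/ins_childrenP. Qed.

(** * The edge cut around a strand *)

Section Cut.
Variables (c : nat) (i j : 'I_n).

(** [b] carries the first wall met on the way from the column [c] to [k], or is [k] itself if there
    is none. *)
Definition stops (k b : 'I_n) : bool :=
  ((b == k) || strictly_between c b k && wall i j b) &&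
  [forall b', strictly_between c b' b ==> ~~ wall i j b'].

(* The cut around the strand from i to j: a label is on the side of i when the
   first wall met on the way to it from column c is below that strand. *)
Definition cut : {set 'I_n} := [set k | [exists b, stops k b && (s b <= s i)]].

Lemma stops_exists k : exists b, stops k b.
Proof.
pose P b := (b == k) || strictly_between c b k && wall i j b.
pose dist (b : 'I_n) := if b < c then c - b else b - c.
have Pk : P k by rewrite /P eqxx.
case: (arg_minnP dist Pk) => b Pb minb; exists b; apply/andP; split=> //.
apply/forallP => b'; apply/implyP => hb'; apply/negP => wb'.
have Pb' : P b'.
  rewrite /P wb' andbT; apply/orP; right; move: Pb hb'.
  by rewrite /P /strictly_between => /orP [/eqP ->|/andP []]; lia.
have := minb _ Pb'; rewrite /dist; move: hb'; rewrite /strictly_between.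
by do 2 case: ifP; lia.
Qed.

Lemma stops_uniq k b b' : stops k b -> stops k b' -> b = b'.
Proof.
case/andP=> kb /forallP nb /andP [kb' /forallP nb'].
apply/eqP/negPn/negP => neq_bb'; move: (nb b') (nb' b); move: neq_bb'.
rewrite -(inj_eq val_inj) /= /strictly_between.
case/orP: kb kb' => [/eqP ->|/andP [hb wb]] /orP [/eqP ->|/andP [hb' wb']];
  first [rewrite wb wb'|rewrite wb|rewrite wb'|idtac];
  move: hb hb' || move: hb || move: hb' || idtac; rewrite /strictly_between; lia.
Qed.

Lemma mem_cut k b : stops k b -> (k \in cut) = (s b <= s i).
Proof.
move=> kb; rewrite inE; apply/existsP/idP => [[b' /andP [kb']]|sb].
  by rewrite (stops_uniq kb kb').
by exists b; rewrite kb.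
Qed.

Hypotheses (cn : c <= n) (cons_ij : consecutive c i j).

(** If a wall stops the way to [k], it also lies between [c'] and [k]. As it spans the strand
    without hiding [k], its label and [k] are on the same side of the strand. *)
Lemma mem_cut_column c' k : hits c' k ->
  (forall b : 'I_n, (c <= b < c') || (c' <= b < c) -> ~~ wall i j b) ->
  (k \in cut) = (s k <= s i).
Proof.
move=> hk nw; have [b kb] := stops_exists k; rewrite (mem_cut kb).
have /and4P [_ _ sij _] := cons_ij.
case/andP: kb => /orP [/eqP -> //|/andP [bk wb] _].
have : strictly_between c' b k.
  have := contraL (nw b) wb; move: bk; rewrite /strictly_between; lia.
move/(hitsP hk); move: wb; rewrite /wall /blocks.
by case: (up b); case: (dn b) => /=; lia.
Qed.

(** Either [b0] is the first wall on the way to [k], or [b0] lies between [c'] and [k]; in the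
    latter case, since [b0] does not hide [k], both are on the same side of the strand. *)
Lemma mem_cut_beyond_wall c' b0 k : hits c' k -> wall i j b0 ->
  (c <= b0 < c') || (c' <= b0 < c) ->
  (forall b, strictly_between c b b0 -> ~~ wall i j b) ->
  (k \in cut) = (s b0 <= s i).
Proof.
move=> hk w0 cc' nw; have [b kb] := stops_exists k.
have /and4P [_ _ sij _] := cons_ij.
have stops0 : (b0 == k) || strictly_between c b0 k -> (k \in cut) = (s b0 <= s i).
  move=> h0; apply: mem_cut; apply/andP; split; first by rewrite w0 andbT.
  by apply/forallP => b'; apply/implyP; apply: nw.
have [/stops0 //|] := boolP ((b0 == k) || strictly_between c b0 k).
rewrite negb_or -(inj_eq val_inj) /= => /andP [neq0 nbetw].
have h0 : strictly_between c' b0 k.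
  by move: cc' neq0 nbetw; rewrite /strictly_between; lia.
have := hitsP hk h0; rewrite (mem_cut kb).
case/andP: kb => /orP [/eqP ->|/andP [bk wb] _].
  by move: w0; rewrite /wall /blocks; case: (up b0); case: (dn b0) => /=; lia.
have : strictly_between c' b k.
  have := contraL (nw b) wb; move: bk cc' neq0 nbetw; rewrite /strictly_between; lia.
move/(hitsP hk); move: w0 wb; rewrite /wall /blocks.
by case: (up b0); case: (dn b0); case: (up b); case: (dn b) => /=; lia.
Qed.

(** If a wall of the strand separates [c] from [c'], the nearest one puts [x] and [y] on the same
    side. Otherwise the strand from [i] to [j] is also present in column [c'], where only itself
    joins labels on its two sides. *)
Lemma cut_edge c' x y : c' <= n -> consecutive c' x y ->
  (x \in cut) != (y \in cut) -> x = i /\ y = j.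
Proof.
move=> c'n cons; have /and4P [hx hy sxy _] := cons.
have [/existsP ex|] := boolP [exists b : 'I_n, wall i j b &&
    ((c <= b < c') || (c' <= b < c))].
  pose P (b : 'I_n) := wall i j b && ((c <= b < c') || (c' <= b < c)).
  pose dist (b : 'I_n) := if b < c then c - b else b - c.
  have {ex} [b1 Pb1] : exists b, P b by [].
  case: (arg_minnP dist Pb1) => b0 /andP [w0 h0] min0.
  have nw b : strictly_between c b b0 -> ~~ wall i j b.
    move=> hb; apply/negP => wb; have Pb : P b.
      by rewrite /P wb /=; move: hb h0; rewrite /strictly_between; lia.
    have := min0 _ Pb; rewrite /dist; move: hb; rewrite /strictly_between.
    by do 2 case: ifP; lia.
  by rewrite (mem_cut_beyond_wall hx w0 h0 nw) (mem_cut_beyond_wall hy w0 h0 nw) eqxx.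
rewrite negb_exists => /forallP nex.
have nw (b : 'I_n) : (c <= b < c') || (c' <= b < c) -> ~~ wall i j b.
  by move=> hb; have := nex b; rewrite hb andbT.
rewrite (mem_cut_column hx nw) (mem_cut_column hy nw) => neq.
have cons' : consecutive c' i j by rewrite -(consecutive_move cn c'n nw).
have eq_xi : x = i.
  have /and4P [_ _ _ /forallP betw'] := cons'; have /and4P [hi _ _ _] := cons'.
  have /and4P [_ _ _ /forallP betw] := cons.
  apply: s_inj; move: (betw i); rewrite hi; lia.
split=> //; rewrite eq_xi in cons; exact: consecutive_inj_target cons cons'.
Qed.

Lemma source_in_cut : i \in cut.
Proof.
have /and4P [hi _ sij _] := cons_ij; rewrite (@mem_cut i i) //.
rewrite /stops eqxx; apply/forallP => b; apply/implyP.
exact: (hits_source_wall hi sij).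
Qed.

Lemma target_notin_cut : j \notin cut.
Proof.
have /and4P [_ hj sij _] := cons_ij; rewrite (@mem_cut j j) -?ltnNge //.
rewrite /stops eqxx; apply/forallP => b; apply/implyP.
exact: (hits_target_wall hj sij).
Qed.

Lemma subtree_sub_cut k : k \in subtree_through (slot_edge ins_parents) j i ->
  k \in cut.
Proof.
rewrite inE => conn.
apply: (connect_invariant (A := fun k => k \in cut) _ conn source_in_cut).
move=> x y /and3P [xj yj /orP [] /ins_parentsP [c' c'n cons]] xcut.
  apply/negPn/negP => ycut; have [|_ yj'] := cut_edge c'n cons.
    by rewrite xcut (negPf ycut).
  by rewrite yj' eqxx in yj.
apply/negPn/negP => ycut; have [|_ xj'] := cut_edge c'n cons.
  by rewrite xcut (negPf ycut).
by rewrite xj' eqxx in xj.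
Qed.

Lemma subtree_sub_cutC k : k \in subtree_through (slot_edge ins_parents) i j ->
  k \notin cut.
Proof.
rewrite inE => conn.
apply: (connect_invariant (A := fun k => k \notin cut) _ conn target_notin_cut).
move=> x y /and3P [xi yi /orP [] /ins_parentsP [c' c'n cons]] xcut.
  apply/negP => ycut; have [|xi' _] := cut_edge c'n cons.
    by rewrite ycut (negPf xcut).
  by rewrite xi' eqxx in xi.
apply/negP => ycut; have [|yi' _] := cut_edge c'n cons.
  by rewrite ycut (negPf xcut).
by rewrite yi' eqxx in yi.
Qed.

End Cut.

Lemma ins_tree : directed_tree (slot_edge ins_parents).
Proof.
split.
- move=> x y /ins_parentsP [c _ /and4P [_ _ sxy _]].
  by apply/ins_parentsP => -[c' _ /and4P [_ _ syx _]]; lia.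
- have und_sym : connect_sym (undirected (slot_edge ins_parents)).
    by apply: sym_connect_sym => x y; rewrite /undirected /= orbC.
  (* Labels visible from one column are joined by the chain of strands of that column. *)
  have column c m x y : c <= n -> hits c x -> hits c y -> s x < s y ->
      s y - s x <= m -> connect (undirected (slot_edge ins_parents)) x y.
    move=> cn; elim: m x y => [|m IHm] x y hx hy sxy sm; first by lia.
    have [cons|] := boolP (consecutive c x y).
      apply: connect1; apply/orP; left; apply/ins_parentsP; by exists c.
    rewrite /consecutive hx hy sxy /= negb_forall => /existsP [z].
    rewrite negb_imply negbK => /andP [hz sz].
    by apply: (@connect_trans _ _ z); apply: IHm => //; lia.
  (* Neighboring labels are both visible from the column between them, which links the columns
     together. *)
  have next (x y : 'I_n) : y = x.+1 :> nat ->
      connect (undirected (slot_edge ins_parents)) x y.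
    move=> eq_y; have hx := hits_right x; have hy := hits_left y.
    rewrite eq_y in hy; have xn := ltn_ord x; have [sxy|syx|/s_inj ->] := ltngtP (s x) (s y).
    - exact: column xn hx hy sxy (leqnn _).
    - by rewrite und_sym; apply: column xn hy hx syx (leqnn _).
    - exact: connect0.
  have le m (x y : 'I_n) : y = x + m :> nat ->
      connect (undirected (slot_edge ins_parents)) x y.
    elim: m y => [|m IHm] y eq_y.
      by rewrite (_ : x = y) //; apply: val_inj; rewrite /= eq_y addn0.
    have lt_n : x + m < n by have := ltn_ord y; lia.
    apply: (@connect_trans _ _ (Ordinal lt_n)); first exact: IHm.
    by apply: next; rewrite /= eq_y addnS.
  move=> x y; have [le_xy|/ltnW le_yx] := leqP x y.
    by apply: (le (y - x)); lia.
  by rewrite und_sym; apply: (le (x - y)); lia.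
- apply: acyclic_of_cuts => x y /ins_parentsP [c cn cons].
  exists (cut c x y); split; first exact: source_in_cut cons.
    exact: target_notin_cut cons.
  move=> u v /ins_parentsP [c' c'n cons']; exact: cut_edge c'n cons'.
Qed.

(** From column [i], the wall above [i] is met at once on the way to any larger label, so all labels
    from [i] on fall on the side of [i], outside the left ancestor subtree. Column [i.+1] is
    symmetric. *)
Lemma ins_parents_ordered i : ordered_at ins_parents i (ins_parents i).
Proof.
rewrite {2}/ins_parents; case: (boolP (up i)) => //= upi; split=> k.
  case eq_above: (above i i) => [j|]; last by rewrite inE.
  have cons : consecutive i i j by rewrite -aboveP eq_above.
  move/(subtree_sub_cutC (ltnW (ltn_ord i)) cons); apply: contraR.
  rewrite -leqNgt => le_ik; rewrite (@mem_cut i i j k i) //.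
  rewrite /stops /wall upi leqnn andbT -(inj_eq val_inj) /=.
  apply/andP; split; first by rewrite /strictly_between; lia.
  by apply/forallP => b; rewrite /strictly_between; lia.
case eq_above: (above i.+1 i) => [j|]; last by rewrite inE.
have cons : consecutive i.+1 i j by rewrite -aboveP eq_above.
move/(subtree_sub_cutC (ltn_ord i) cons); apply: contraR.
rewrite -leqNgt => le_ik; rewrite (@mem_cut i.+1 i j k i) //.
rewrite /stops /wall upi leqnn andbT -(inj_eq val_inj) /=.
apply/andP; split; first by rewrite /strictly_between; lia.
by apply/forallP => b; rewrite /strictly_between; lia.
Qed.

Lemma ins_children_ordered j : ordered_at ins_parents j (ins_children j).
Proof.
rewrite /ins_children; case: (boolP (dn j)) => //= dnj; split=> k.
  case eq_below: (below j j) => [i|]; last by rewrite inE.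
  have cons : consecutive j i j by rewrite -belowP eq_below.
  have /and4P [_ _ sij _] := cons.
  move/(subtree_sub_cut (ltnW (ltn_ord j)) cons); apply: contraTT.
  rewrite -leqNgt => le_ik; rewrite (@mem_cut j i j k j) -?ltnNge //.
  rewrite /stops /wall dnj leqnn orbT andbT -(inj_eq val_inj) /=.
  apply/andP; split; first by rewrite /strictly_between; lia.
  by apply/forallP => b; rewrite /strictly_between; lia.
case eq_below: (below j.+1 j) => [i|]; last by rewrite inE.
have cons : consecutive j.+1 i j by rewrite -belowP eq_below.
have /and4P [_ _ sij _] := cons.
move/(subtree_sub_cut (ltn_ord j) cons); apply: contraTT.
rewrite -leqNgt => le_ik; rewrite (@mem_cut j.+1 i j k j) -?ltnNge //.
rewrite /stops /wall dnj leqnn orbT andbT -(inj_eq val_inj) /=.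
apply/andP; split; first by rewrite /strictly_between; lia.
by apply/forallP => b; rewrite /strictly_between; lia.
Qed.

Definition insertion : permutree n :=
  Permutree ins_childrenE ins_tree ins_parents_ordered ins_children_ordered.

Lemma decoration_insertion : decoration insertion = delta.
Proof.
apply: eq_from_tnth => i; rewrite tnth_mktuple /symbol_at /= /ins_parents /ins_children.
by case: (tnth delta i).
Qed.

Lemma insertion_edge i j : edge insertion i j -> s i < s j.
Proof. by case/ins_parentsP => c _ /and4P []. Qed.

End Insertion.

(** Heights are ranks in a sorted list of the labels, which breaks ties of [v] and makes the heights
    distinct. This is the covering property of the cones. *)
Lemma permutree_extension (R : realType) (n : nat) (delta : n.-tuple symbol)
    (v : 'I_n -> R) :
  exists T : permutree n, decoration T = delta /\
    forall i j, edge T i j -> (v i <= v j)%R.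
Proof.
pose r : seq 'I_n := sort (fun a b => (v a <= v b)%R) (enum 'I_n).
have mem_r k : k \in r by rewrite mem_sort mem_enum.
pose s k := index k r.
have s_inj : injective s.
  by move=> x y eq_s; rewrite -(nth_index x (mem_r x)) -/(s x) eq_s nth_index.
exists (insertion delta s_inj); split; first exact: decoration_insertion.
move=> i j /insertion_edge sij.
have sorted_r : sorted (fun a b => (v a <= v b)%R) r.
  by apply: sort_sorted => a b; apply: le_total.
have tr : transitive (fun a b => (v a <= v b)%R).
  by move=> a b c; apply: le_trans.
have := sorted_ltn_nth tr i sorted_r (s i) (s j).
by rewrite !inE !index_mem !mem_r !nth_index //; apply.
Qed.

(** * Edge cuts *)

Lemma eq_subtree_through (V : finType) (e e' : rel V) :
  undirected e =2 undirected e' -> subtree_through e =2 subtree_through e'.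
Proof.
move=> eq_und i j; apply/setP=> k; rewrite !inE; apply: eq_connect => x y /=.
by rewrite -[RHS]/([&& _, _ & undirected e' x y]) -eq_und.
Qed.

Lemma eq_directed_tree (V : finType) (e e' : rel V) :
  undirected e =2 undirected e' -> (forall x y, e' x y -> ~~ e' y x) ->
  directed_tree e -> directed_tree e'.
Proof.
move=> eq_und asym [_ conn acyc]; split=> // [x y|c szc].
  by rewrite -(eq_connect eq_und).
by rewrite /ucycle -(eq_cycle eq_und); apply: acyc.
Qed.

(** * Reversal of all edges *)

Section Opposite.
Variables (n : nat) (T : permutree n).

Lemma opposite_und :
  undirected (slot_edge (parents T)) =2 undirected (slot_edge (children T)).
Proof. by move=> i j; rewrite /undirected /slot_edge /= !childrenE orbC. Qed.

Lemma opposite_childrenE i j :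
  (Some j \in (children T i : seq _)) = (Some i \in (parents T j : seq _)).
Proof. by rewrite childrenE. Qed.

Lemma opposite_tree : directed_tree (slot_edge (children T)).
Proof.
apply: (eq_directed_tree opposite_und) (permutree_tree T).
by have [asym _ _] := permutree_tree T => x y; rewrite /slot_edge /= -!childrenE; apply: asym.
Qed.

Lemma opposite_ordered i s :
  ordered_at (parents T) i s -> ordered_at (children T) i s.
Proof.
have eq_sub o : slot_subtree (parents T) i o = slot_subtree (children T) i o.
  by case: o => // j; apply: eq_subtree_through opposite_und i j.
by case: s => //= l r; rewrite !eq_sub.
Qed.

(** Reversal exchanges the symbols U and D, and peaks with valleys; statements on upper walls are
    deduced from those on lower walls. *)
Definition opposite : permutree n :=
  Permutree opposite_childrenE opposite_tree
    (fun i => opposite_ordered (children_ordered T i))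
    (fun i => opposite_ordered (parents_ordered T i)).

Lemma opposite_edge i j : edge opposite i j = edge T j i.
Proof. by rewrite /edge /slot_edge /= childrenE. Qed.

Lemma opposite_subtree i j :
  subtree_through (edge opposite) i j = subtree_through (edge T) i j.
Proof. exact/esym/eq_subtree_through/opposite_und. Qed.

Lemma opposite_down i :
  has_down (symbol_at opposite i) = has_up (symbol_at T i).
Proof. by rewrite /symbol_at /=; case: (children T i); case: (parents T i). Qed.

End Opposite.

Section PermutreeLemmas.
Variables (n : nat) (T : permutree n).
Local Notation B := (subtree_through (edge T)).
Local Notation und := (undirected (edge T)).
Let tree : directed_tree (edge T) := permutree_tree T.

Lemma edge_child i j : edge T i j = (Some i \in (children T j : seq _)).
Proof. exact: childrenE. Qed.

Lemma has_down_child q x : has_down (symbol_at T q) -> edge T x q ->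
  (forall k, k \in B q x -> k < q) \/ (forall k, k \in B q x -> q < k).
Proof.
rewrite edge_child /symbol_at; have := children_ordered T q.
case: (children T q) => [o|l r]; first by case: (parents T q).
move=> /= [ltl ltr] _; rewrite !inE.
by case/orP=> /eqP eq_o; [left|right]; [move: ltl|move: ltr]; rewrite -eq_o.
Qed.

Lemma two_children q x y : edge T x q -> edge T y q -> x != y ->
  has_down (symbol_at T q) /\
  (((forall k, k \in B q x -> k < q) /\ (forall k, k \in B q y -> q < k)) \/
   ((forall k, k \in B q x -> q < k) /\ (forall k, k \in B q y -> k < q))).
Proof.
rewrite !edge_child /symbol_at; have := children_ordered T q.
case: (children T q) => [o _|l r [ltl ltr]]; rewrite !inE.
  by move=> /eqP <- /eqP [->]; rewrite eqxx.
move=> hx hy neq_xy; split; first by case: (parents T q).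
case/orP: hx hy => /eqP eq_x; case/orP => /eqP eq_y.
- by move: neq_xy; rewrite -eq_x in eq_y; case: eq_y => ->; rewrite eqxx.
- by left; move: ltl ltr; rewrite -eq_x -eq_y.
- by right; move: ltl ltr; rewrite -eq_x -eq_y.
- by move: neq_xy; rewrite -eq_x in eq_y; case: eq_y => ->; rewrite eqxx.
Qed.

(** The peak has two children, whose subtrees contain [u] and [w] and lie on opposite sides of its
    label. *)
Lemma peak_between u v p w : uniq (u :: rcons (v :: p) w) ->
  path und u (rcons (v :: p) w) -> edge T u v -> edge T w (last v p) ->
  exists q, [/\ q \in v :: p, has_down (symbol_at T q) & (u < q < w) || (w < q < u)].
Proof.
move=> uniq_p pathp euv ew.
have [q [x [y [qp exq eyq xy [uB wB]]]]] := peak_on_path tree uniq_p pathp euv ew.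
have [down_q sides] := two_children exq eyq xy; exists q; split=> //.
by case: sides => -[/(_ _ uB) -> /(_ _ wB) ->]; rewrite ?orbT.
Qed.

(* An edge cut seen from a vertex b on its upper side: the path from b to the
   cut starts downwards, or it starts upwards and turns at a vertex with two
   children. *)
Lemma edge_cut_down i j (a b c : 'I_n) : edge T i j -> a < b < c ->
  a \in B j i -> c \in B j i -> b \notin B j i -> ~~ has_down (symbol_at T b).
Proof.
move=> eij /andP [ab bc] aB cB bB; apply/negP => down_b.
have uij := edge_und eij; have neq_ij := und_neq tree uij.
have uji : und j i by rewrite undC.
have neq_ji := und_neq tree uji.
(* If the cut edge is reached through a child of [b], the whole source side lies in that descendant
   subtree, hence on one side of [b], although it contains both [a] and [c]. *)
have child_abs x : edge T x b -> i \in B b x -> False.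
  move=> exb iB; have neq_bx : b != x by rewrite (und_neq tree) // (edge_und' exb).
  have sub := subtree_sub neq_ji neq_bx bB iB.
  have [lt_b|gt_b] := has_down_child down_b exb.
    by have := ltn_trans bc (lt_b _ (sub _ cB)); rewrite ltnn.
  by have := ltn_trans ab (gt_b _ (sub _ aB)); rewrite ltnn.
have bB' : b \in B i j by rewrite (subtree_compl tree uji) inE.
have neq_ib : i != b by apply: contraNneq bB => <-; apply: mem_subtree_root.
have jB : j \in B i b by rewrite mem_subtreeC.
have [p [pathp uniq_p lastp ip]] := avoiding_path neq_ib jB.
have {bB'} above z : z \in b :: p -> z \notin B j i.
  move=> /(subtree_path pathp ip) zB; rewrite (subtree_compl tree uij) inE negbK.
  exact: mem_subtree_trans bB' zB.
have {jB} pathi : path und b (rcons p i) by rewrite rcons_path pathp lastp undC.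
have uniq_i : uniq (b :: rcons p i) by rewrite -rcons_cons rcons_uniq ip.
case: p pathp uniq_p lastp ip above pathi uniq_i => [|v p].
  move=> _ _ /= eq_b _ _ _ _; apply: (child_abs i); last exact: mem_subtree_root.
  by rewrite eq_b.
move=> pathp uniq_p lastp ip above pathi uniq_i.
have [/orP [ebv|evb] _] : und b v /\ path und v p by exact/andP.
  have eil : edge T i (last v p) by rewrite -lastp in eij.
  have [q [x [y [qp exq eyq xy [bq iq]]]]] :=
    peak_on_path tree uniq_i pathi ebv eil.
  have qB : q \notin B j i by apply: above; rewrite inE qp orbT.
  have neq_qy : q != y by rewrite (und_neq tree) // (edge_und' eyq).
  have sub := subtree_sub neq_ji neq_qy qB iq.
  (* The label [q] separates [b] from the whole source side, whereas [b] lies between [a] and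
     [c]. *)
  have [_ [[/(_ _ bq) bq' gt_q]|[/(_ _ bq) qb lt_q]]] := two_children exq eyq xy.
    have := ltn_trans bq' (gt_q _ (sub _ aB)).
    by move/(ltn_trans ab); rewrite ltnn.
  have := ltn_trans (lt_q _ (sub _ cB)) qb.
  by move/(ltn_trans bc); rewrite ltnn.
apply: (child_abs v evb); apply: (@subtree_path _ _ _ _ (rcons p i)).
- by move: pathi => /= /andP [].
- by move: uniq_i => /= /andP [].
- by rewrite inE mem_rcons mem_head orbT.
Qed.


End PermutreeLemmas.

Lemma edge_cut_up n (T : permutree n) i j (a b c : 'I_n) : edge T i j ->
  a < b < c -> a \notin subtree_through (edge T) j i ->
  c \notin subtree_through (edge T) j i -> b \in subtree_through (edge T) j i ->
  ~~ has_up (symbol_at T b).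
Proof.
move=> eij abc; have uij := edge_und' eij.
have compl z : (z \in subtree_through (edge T) j i) =
    (z \notin subtree_through (edge (opposite T)) i j).
  by rewrite opposite_subtree (subtree_compl (permutree_tree T) uij) finset.in_setC negbK.
rewrite !compl !negbK -opposite_down.
by apply: edge_cut_down abc; rewrite opposite_edge.
Qed.

Lemma valley_between n (T : permutree n) u v p w : uniq (u :: rcons (v :: p) w) ->
  path (undirected (edge T)) u (rcons (v :: p) w) ->
  edge T v u -> edge T (last v p) w ->
  exists q, [/\ q \in v :: p, has_up (symbol_at T q) & (u < q < w) || (w < q < u)].
Proof.
move=> uniq_p pathp euv ew.
have [||//|q [qp + betw]] := @peak_between _ (opposite T) u v p w uniq_p.
- by rewrite -(eq_path (opposite_und T)).
- by rewrite opposite_edge.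
- by rewrite opposite_edge.
by rewrite opposite_down => up_q; exists q.
Qed.

(** This depends on [delta] alone, so a block cut out by one permutree can be tested against any
    other one with the same decoration. *)
Definition admissible n (delta : n.-tuple symbol) (I : {set 'I_n}) : Prop :=
  forall a b c : 'I_n, a < b < c ->
    (a \in I -> c \in I -> has_down (tnth delta b) -> b \in I) /\
    (a \notin I -> c \notin I -> has_up (tnth delta b) -> b \notin I).

Lemma building_block_admissible n (delta : n.-tuple symbol) (I : {set 'I_n}) :
  building_block delta I -> admissible delta I.
Proof.
case=> T [<- [i [j [eij ->]]]] a b c abc.
rewrite (source_sideE (permutree_tree T) eij) tnth_mktuple.
split=> aI cI; first by apply: contraTT; apply: (edge_cut_down eij abc).
by apply: contraTN; apply: (edge_cut_up eij abc).
Qed.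

Lemma building_block_proper n (delta : n.-tuple symbol) (I : {set 'I_n}) :
  building_block delta I -> exists i j, i \in I /\ j \notin I.
Proof.
case=> T [_ [i [j [eij ->]]]]; exists i, j.
rewrite (source_sideE (permutree_tree T) eij) mem_subtree_root; split=> //.
apply: subtree_self; apply: (und_neq (permutree_tree T)).
exact: edge_und'.
Qed.

(** * Block sums of the vertices *)

Local Open Scope ring_scope.

Lemma sum_indicator (R : pzSemiRingType) (V : finType) (A : {set V}) :
  \sum_(x : V) (x \in A)%:R = #|A|%:R :> R.
Proof. by rewrite -sum1_card natr_sum [RHS]big_mkcond; apply: eq_bigr => x _; case: ifP. Qed.

Lemma sum_separated (R : pzRingType) (V : finType) (A : {set V}) :
  \sum_(x : V) \sum_(y : V) ((x \in A) != (y \in A))%:R =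
  (#|A|%:R * (#|V|%:R - #|A|%:R)) *+ 2 :> R.
Proof.
have sumC : \sum_(y : V) (y \notin A)%:R = #|V|%:R - #|A|%:R :> R.
  rewrite -[in RHS](cardsC A) natrD addrAC subrr add0r -sum_indicator.
  by apply: eq_bigr => y _; rewrite inE.
have eq_in x : \sum_(y : V) ((x \in A) != (y \in A))%:R =
    (x \in A)%:R * (#|V|%:R - #|A|%:R) + (x \notin A)%:R * #|A|%:R :> R.
  case: (x \in A); rewrite !(mul0r, mul1r, addr0, add0r).
    by rewrite -sumC; apply: eq_bigr => y _; case: (y \in A).
  by rewrite -sum_indicator; apply: eq_bigr => y _; case: (y \in A).
under eq_bigr => x _ do rewrite eq_in.
rewrite big_split /= -!mulr_suml sumC sum_indicator mulr2n mulrBr mulrBl.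
by rewrite -!natrM mulnC.
Qed.

Section TreeInequality.
Variables (R : realType) (n : nat) (T : permutree n).
Local Notation B := (subtree_through (edge T)).
Local Notation und := (undirected (edge T)).
Let tree : directed_tree (edge T) := permutree_tree T.

Section Crossings.
Variable I : {set 'I_n}.

Definition crossing (p : 'I_n * 'I_n) : R := (p.1 \in I)%:R - (p.2 \in I)%:R.

Definition separates (p : 'I_n * 'I_n) (a c : 'I_n) : bool :=
  (a \in B p.2 p.1) != (c \in B p.2 p.1).

(* The edges separating a and c are those on the path from a to c. *)
Definition crossings (a c : 'I_n) : R :=
  \sum_(p : 'I_n * 'I_n | edge T p.1 p.2) crossing p * (separates p a c)%:R.

Lemma crossingsxx a : crossings a a = 0.
Proof. by apply: big1 => p _; rewrite /separates eqxx mulr0. Qed.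

(** Only the edge between [z] and [z'] distinguishes the paths from [a] to these two vertices; the
    hypothesis on [B] says that [z'] is the farther one. *)
Lemma crossings_step a z z' : und z z' -> a \in B z' z ->
  crossings a z' =
  crossings a z + (if edge T z z' then crossing (z, z') else crossing (z', z)).
Proof.
move=> uzz' aB; have uz'z : und z' z by rewrite undC.
pose p0 := if edge T z z' then (z, z') else (z', z).
have p0E : (if edge T z z' then crossing (z, z') else crossing (z', z)) = crossing p0.
  by rewrite /p0; case: ifP.
have edge_p0 : edge T p0.1 p0.2.
  rewrite /p0; case: ifP => //= nzz'; move: uzz'; rewrite /undirected /=.
  by rewrite nzz'.
have sep_z : separates p0 a z = false.
  rewrite /separates /p0; case: ifP => _ /=; first by rewrite aB mem_subtree_root.
  by rewrite (subtree_compl tree uz'z) !finset.in_setC aB mem_subtree_root.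
have sep_z' : separates p0 a z' = true.
  have nz' := subtree_self (edge T) (und_neq tree uz'z).
  rewrite /separates /p0; case: ifP => _ /=; first by rewrite aB nz'.
  by rewrite (subtree_compl tree uz'z) !finset.in_setC aB nz'.
rewrite p0E /crossings (bigD1 p0) // [in RHS](bigD1 p0) //= sep_z sep_z'.
rewrite mulr0 add0r mulr1 addrC; congr (_ + _).
apply: eq_bigr => p /andP [ep neq_p]; congr (_ * _%:R).
rewrite /separates (subtree_adj tree (edge_und' ep) uzz') //.
apply: contra neq_p; rewrite /p0 => /orP [] /andP [/eqP ez /eqP ez'].
  have -> : edge T z z' = false.
    by apply/negbTE; have [asym _ _] := tree; rewrite ez ez'; apply: asym.
  by rewrite ez ez' -surjective_pairing.
by rewrite ez ez' ep -surjective_pairing.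
Qed.

Hypothesis admI : admissible (decoration T) I.

(** For a step across the boundary of [I], this says that the edge leaves [I] upwards, in whichever
    direction it is traversed: such a step counts +1. *)
Definition positive_step (z z' : 'I_n) : bool :=
  if z \in I then edge T z z' else edge T z' z.

(** The last crossing of the boundary of [I] along the path is the step from [u] to [v], and it is
    positive. *)
Definition last_positive (a : 'I_n) (p : seq 'I_n) : Prop :=
  exists p1 u v p2, [/\ a :: p = p1 ++ [:: u, v & p2],
    positive_step u v, (u \in I) != (last a p \in I) &
    forall w, w \in v :: p2 -> (w \in I) = (last a p \in I)].

(** Between two positive crossings the path stays on one side of [I]. Outside [I] it goes up first
    and down last, so it has a peak outside [I] whose label lies between two labels of [I]; inside
    [I] it has a valley with the dual property. Admissibility excludes both. *)
Lemma no_consecutive_positive a p z' : path und a (rcons p z') ->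
  uniq (a :: rcons p z') -> last_positive a p ->
  (last a p \in I) != (z' \in I) -> ~~ positive_step (last a p) z'.
Proof.
move=> pathp uniq_p [p1 [u [v [p2 [eq_p pos neq_u same]]]]] neq_z'.
have last_v : last a p = last v p2.
  by rewrite -[LHS]/(last a (a :: p)) eq_p last_cat.
have uniq_u : uniq (u :: rcons (v :: p2) z').
  move: uniq_p; rewrite -rcons_cons eq_p rcons_cat cat_uniq => /and3P [_ _].
  by rewrite !rcons_cons.
have path_u : path und u (rcons (v :: p2) z').
  case: p1 eq_p pathp {uniq_p} => [|x p1] [-> ->].
    by rewrite rcons_cons.
  by rewrite rcons_cat cat_path => /andP [_]; rewrite rcons_cons /= => /andP [].
have eq_z'u : (z' \in I) = (u \in I).
  by move: neq_u neq_z'; do 3 case: (_ \in I).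
apply/negP; move: neq_u neq_z' pos; rewrite /positive_step eq_z'u last_v.
case uI : (u \in I); case lI : (last v p2 \in I) => // _ _ euv ez.
  have [q [qp down_q]] := peak_between uniq_u path_u euv ez.
  have qI : q \notin I by rewrite same // last_v lI.
  have dq : has_down (tnth (decoration T) q) by rewrite tnth_mktuple.
  case/orP=> /admI [] + _ => /(_ _ _ dq); rewrite (negPf qI) eq_z'u uI => h;
    by have := h isT isT.
have [q [qp up_q]] := valley_between uniq_u path_u euv ez.
have qI : q \in I by rewrite same // last_v lI.
have dq : has_up (tnth (decoration T) q) by rewrite tnth_mktuple.
case/orP=> /admI [] _ => /(_ _ _ dq); rewrite qI eq_z'u uI => h;
  by have := h isT isT.
Qed.

(** As positive crossings are never consecutive, an even number of crossings sums to at most 0, and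
    an odd number to at most -1 unless the last one is positive. Recording that last sign makes the
    induction go through. *)
Lemma crossings_path a p : path und a p -> uniq (a :: p) ->
  if (a \in I) == (last a p \in I) then is_true (crossings a (last a p) <= 0)
  else crossings a (last a p) <= - 1 \/
       crossings a (last a p) <= 1 /\ last_positive a p.
Proof.
elim/last_ind: p => [|p z' IHp]; first by rewrite /= eqxx crossingsxx.
move=> pathp uniq_p; have := pathp; rewrite rcons_path => /andP [pathp' uzz'].
have := uniq_p; rewrite -rcons_cons rcons_uniq => /andP [z'p uniq_p'].
have nolast := no_consecutive_positive pathp uniq_p.
have {IHp} := IHp pathp' uniq_p'; rewrite last_rcons.
set z := last a p in uzz' nolast *.
have aB : a \in B z' z.
  have z'a : z' != a by apply: contraNneq z'p => ->; rewrite mem_head.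
  rewrite mem_subtreeC; apply: (subtree_path (p := p)) => //.
  exact: mem_last.
rewrite (crossings_step uzz' aB).
have [same|cross] := eqVneq (z \in I) (z' \in I).
  have -> : (if edge T z z' then crossing (z, z') else crossing (z', z)) = 0.
    by rewrite /crossing /= same; case: ifP => _; rewrite subrr.
  rewrite addr0 same; case: ifP => // _ [|[le1 [p1 [u [v [p2 [eq_p pos neq_u all_v]]]]]]].
    by left.
  right; split=> //; exists p1, u, v, (rcons p2 z'); rewrite last_rcons -same.
  split=> //; first by rewrite -(rcons_cons a) eq_p rcons_cat.
  by move=> w; rewrite -rcons_cons mem_rcons inE => /orP [/eqP ->|/all_v].
have step_sign : (if edge T z z' then crossing (z, z') else crossing (z', z)) =
    if positive_step z z' then 1 else -1.
  rewrite /positive_step /crossing /=; move: uzz'; rewrite /undirected /=.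
  have [asym _ _] := tree; have := asym z z'; rewrite -/(edge T z z') -/(edge T z' z).
  move: cross; case: (z \in I); case: (z' \in I) => //= _;
    case: (edge T z z'); case: (edge T z' z) => //= h; rewrite ?subr0 ?sub0r //;
    by have := h isT.
rewrite step_sign.
have [eq_a|neq_a] := eqVneq (a \in I) (z \in I).
  rewrite eq_a (negPf cross) => le0.
  case: ifP => pos; [right; split; first lra|left; lra].
  exists (belast a p), z, z', [::]; rewrite last_rcons; split=> //.
    by rewrite -(rcons_cons a) lastI -/z -cats1 -cats1 -catA.
  by move=> w; rewrite inE => /eqP ->.
have -> : (a \in I) == (z' \in I).
  by move: neq_a cross; do 3 case: (_ \in I).
case=> [le1|[le1 /nolast /(_ cross) /negPf ->]]; last by lra.
by case: ifP; lra.
Qed.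

Lemma crossings_le a c : crossings a c <= ((a \in I) != (c \in I))%:R.
Proof.
have [_ conn _] := tree.
have [p [pathp uniq_p <-]] := uniq_path_of_connect (conn a c).
have := crossings_path pathp uniq_p; case: eqP => _ //.
by case=> [le1|[]] //; apply: le_trans le1 (le_trans (lerN10 _) (ler0n _ _)).
Qed.

Lemma sum_crossings :
  \sum_a \sum_c crossings a c = 
  \sum_(p : 'I_n * 'I_n | edge T p.1 p.2)
    crossing p * (#|B p.2 p.1|%:R * (n%:R - #|B p.2 p.1|%:R)) *+ 2.
Proof.
rewrite /crossings; under eq_bigr => a _ do rewrite exchange_big.
rewrite exchange_big; apply: eq_bigr => p _ /=.
under eq_bigr => a _ do rewrite -mulr_sumr.
by rewrite -mulr_sumr sum_separated card_ord mulrnAr.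
Qed.

(* If no pair is slack, no edge enters I upwards, and two edges leaving I would
   both separate some pair. *)
Lemma tight_edge_cut : (forall a c, crossings a c = ((a \in I) != (c \in I))%:R) ->
  (exists i j, i \in I /\ j \notin I) -> exists i j, edge T i j /\ I = B j i.
Proof.
move=> tight [a [c [aI cI]]].
have edge_crossing x y : edge T x y -> crossing (x, y) = ((x \in I) != (y \in I))%:R.
  move=> exy; have := tight x y.
  rewrite (crossings_step (edge_und exy)) ?mem_subtree_root // crossingsxx exy.
  by rewrite add0r.
(* By connectedness some edge joins [I] to its complement; tightness then forces it to leave [I]
   upwards. *)
have [i [j [iI jI uij]]] : exists i j, [/\ i \in I, j \notin I & und i j].
  have [_ conn _] := tree.
  case: (pselect (exists i j, [/\ i \in I, j \notin I & und i j])) => // nex.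
  suff : c \in I by rewrite (negPf cI).
  apply: (connect_invariant (A := fun k => k \in I) _ (conn a c) aI).
  move=> x y uxy xI; apply/negPn/negP => yI; apply: nex; by exists x, y.
have eij : edge T i j.
  case/orP: uij => // /edge_crossing; rewrite /crossing /= iI (negPf jI) /=.
  by move=> h; exfalso; move: h; lra.
have cross_ge0 p : edge T p.1 p.2 -> 0 <= crossing p.
  by case: p => x y /= /edge_crossing ->; apply: ler0n.
have unique x y : edge T x y -> (x \in I) != (y \in I) -> (x, y) = (i, j).
  move=> exy neq_xy; apply/eqP/negPn/negP => neq.
  (* [a'] and [c'] are the ends of the two edges farthest from each other, so both edges separate
     them and contribute 2 to a sum bounded by 1. *)
  pose a' := if x \in B j i then j else i.
  pose c' := if i \in B y x then y else x.
  have uji := edge_und' eij; have uyx := edge_und' exy.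
  have njj := subtree_self (edge T) (und_neq tree uji).
  have nyy := subtree_self (edge T) (und_neq tree uyx).
  have rij := mem_subtree_root (edge T) j i.
  have rxy := mem_subtree_root (edge T) y x.
  have neq_edges : ~~ ((x == j) && (y == i) || (x == i) && (y == j)).
    rewrite negb_or; apply/andP; split; last by apply: neq.
    apply: contraL eij => /andP [/eqP <- /eqP <-].
    by have [asym _ _] := tree; apply: asym.
  have same_xy : (x \in B j i) = (y \in B j i).
    by apply: (subtree_adj tree uji (edge_und exy)).
  have same_ij : (i \in B y x) = (j \in B y x).
    apply: (subtree_adj tree uyx (edge_und eij)).
    apply: contra neq_edges => /orP [] /andP [/eqP -> /eqP ->]; rewrite !eqxx ?orbT //.
  have sep_ij : separates (i, j) a' c'.
    rewrite /separates /a' /c' /=; case: ifP => xB; case: ifP => _;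
      by rewrite ?(negPf njj) ?rij -?same_xy ?xB.
  have sep_xy : separates (x, y) a' c'.
    rewrite /separates /a' /c' /=; case: ifP => _; case: ifP => iB;
      by rewrite ?(negPf nyy) ?rxy -?same_ij ?iB.
  have := crossings_le a' c'; rewrite /crossings (bigD1 (i, j)) //=.
  rewrite (bigD1 (x, y)) /=; last by rewrite exy; apply: neq.
  rewrite sep_ij sep_xy !mulr1 !edge_crossing // neq_xy iI jI.
  set rest := \sum_(_ | _) _; have rest_ge0 : 0 <= rest.
    apply: sumr_ge0 => p /andP [/andP [ep _] _]; apply: mulr_ge0 (ler0n _ _).
    exact: cross_ge0.
  have : ((a' \in I) != (c' \in I))%:R <= 1 :> R by rewrite lern1 leq_b1.
  by move: rest_ge0; rewrite /=; lra.
have closed x y : und x y -> ~~ ((x == i) && (y == j) || (y == i) && (x == j)) ->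
    (x \in I) = (y \in I).
  move=> uxy nxy; apply/eqP/negPn/negP => neq; case/orP: uxy => exy.
    by case: (unique _ _ exy neq) => ex ey; rewrite ex ey !eqxx in nxy.
  rewrite eq_sym in neq; case: (unique _ _ exy neq) => ex ey.
  by rewrite ex ey !eqxx orbT in nxy.
exists i, j; split=> //; apply/setP => k; apply/idP/idP; last first.
  rewrite inE => conn.
  apply: (connect_invariant (A := fun k => k \in I) _ conn iI).
  move=> x y /and3P [xj yj uxy]; rewrite (closed x y uxy) //.
  by rewrite (negPf xj) (negPf yj) !andbF.
apply: contraTT; rewrite (subtree_compl tree (edge_und eij)) finset.in_setC negbK inE => conn.
apply: (connect_invariant (A := fun k => k \notin I) _ conn jI).
move=> x y /and3P [xi yi uxy]; rewrite (closed x y uxy) //.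
by rewrite (negPf xi) (negPf yi) !andFb.
Qed.

End Crossings.

(** Leaves count for 0, and the order condition prevents the two slots from holding the same
    label. *)
Lemma sum_slots (s : slots (option 'I_n)) (F : 'I_n -> R) i :
  ordered_at (parents T) i s ->
  \sum_(x | Some x \in (s : seq _)) F x = \sum_(o <- s) oapp F 0 o.
Proof.
move=> ord_s; have uniq_s : uniq (pmap id (s : seq (option 'I_n))).
  case: s ord_s => [[x|]|[x|] [y|]] //= [lt_i gt_i]; rewrite inE andbT.
  apply/eqP => eq_xy; have := lt_i x (mem_subtree_root _ _ _).
  by have := gt_i y (mem_subtree_root _ _ _); rewrite eq_xy; lia.
have -> : \sum_(o <- s) oapp F 0 o = \sum_(x <- pmap id (s : seq (option 'I_n))) F x.
  elim: (s : seq _) => [|[x|] s' IHs]; rewrite ?big_nil // !big_cons IHs //=.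
  by rewrite add0r.
rewrite big_uniq //; apply: eq_bigl => x.
by rewrite mem_pmap map_id.
Qed.

Lemma sum_subtrees i : \sum_(j | und i j) #|B i j|%:R = n%:R - 1 :> R.
Proof.
under eq_bigr => j _ do rewrite -sum_indicator.
rewrite exchange_big /= (bigD1 i) //= big1 ?add0r; last first.
  by move=> j uij; rewrite (negPf (subtree_self (edge T) (und_neq tree uij))).
rewrite (eq_bigr (fun _ => 1)) => [|k ki].
  have n_gt0 : (0 < n)%N := leq_ltn_trans (leq0n i) (ltn_ord i).
  by rewrite sumr_const cardC1 card_ord -[in RHS](prednK n_gt0) -natr1 addrK.
have [j uij kB] := subtree_cover tree ki.
rewrite (bigD1 j) //= kB big1 ?addr0 // => j' /andP [uij' neq_j].
case kB' : (k \in B i j') => //.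
by rewrite (subtree_disjoint tree uij' uij kB' kB) eqxx in neq_j.
Qed.

(** Put G(m) = m (n - m), which is invariant under m -> n - m. The edges at [i] contribute G of the
    subtree sizes, positively for children and negatively for parents. As these sizes add up to n -
    1, each of the four symbols leaves a polynomial identity. *)
Lemma permutree_pointE i : permutree_point R T 0 i =
  (n%:R + 1) / 2 + 2^-1 * \sum_(p : 'I_n * 'I_n | edge T p.1 p.2)
    #|B p.2 p.1|%:R * (n%:R - #|B p.2 p.1|%:R) * ((p.2 == i)%:R - (p.1 == i)%:R).
Proof.
pose G (m : R) := m * (n%:R - m).
pose size o : R := (subtree_size T i o)%:R.
have sum_children : \sum_(x | edge T x i) G #|B i x|%:R = \sum_(o <- children T i) G (size o).
  under eq_bigl => x do rewrite edge_child.
  rewrite (sum_slots _ (children_ordered T i)); apply: eq_bigr => -[x|] _ //=.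
  by rewrite /G /size /subtree_size /= cards0 mul0r.
have sum_parents : \sum_(x | edge T i x) G #|B i x|%:R = \sum_(o <- parents T i) G (size o).
  rewrite (sum_slots _ (parents_ordered T i)); apply: eq_bigr => -[x|] _ //=.
  by rewrite /G /size /subtree_size /= cards0 mul0r.
have sum_size : \sum_(o <- children T i) size o + \sum_(o <- parents T i) size o = n%:R - 1.
  rewrite -(sum_subtrees i).
  have oappE o : size o = oapp (fun x => #|B i x|%:R) 0 o.
    by rewrite /size /subtree_size; case: o => //=; rewrite cards0.
  under eq_bigr => o _ do rewrite oappE.
  under [X in _ + X]eq_bigr => o _ do rewrite oappE.
  rewrite -(sum_slots _ (children_ordered T i)) -(sum_slots _ (parents_ordered T i)).
  under eq_bigl => x do rewrite -edge_child.
  rewrite [LHS]addrC [RHS](bigID (edge T i)) /=; congr (_ + _).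
    by apply: eq_bigl => x; rewrite -[LHS]/(edge T i x) /undirected /=;
      case: (edge T i x); rewrite /= ?andbF.
  apply: eq_bigl => x; rewrite /undirected /=.
  case eix: (edge T i x) => /=; last by rewrite andbT.
  by have [asym _ _] := tree; apply/negbTE/asym.
have -> : \sum_(p : 'I_n * 'I_n | edge T p.1 p.2)
    #|B p.2 p.1|%:R * (n%:R - #|B p.2 p.1|%:R) * ((p.2 == i)%:R - (p.1 == i)%:R) =
    \sum_(o <- children T i) G (size o) - \sum_(o <- parents T i) G (size o) :> R.
  rewrite -sum_children -sum_parents.
  under eq_bigr => p _ do rewrite mulrBr.
  rewrite sumrB; congr (_ - _).
    rewrite -(pair_big_dep xpredT (edge T)
      (fun x y => #|B y x|%:R * (n%:R - #|B y x|%:R) * (y == i)%:R)) /=.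
    rewrite [RHS]big_mkcond; apply: eq_bigr => x _.
    rewrite big_mkcond (bigD1 i) //= eqxx mulr1 big1 ?addr0 // => y /negPf ->.
    by rewrite mulr0 if_same.
  rewrite -(pair_big_dep xpredT (edge T)
    (fun x y => #|B y x|%:R * (n%:R - #|B y x|%:R) * (x == i)%:R)) /=.
  rewrite (bigD1 i) //= [X in _ + X]big1 ?addr0; last first.
    by move=> x /negPf ->; apply: big1 => y _; rewrite mulr0.
  apply: eq_bigr => y eiy; rewrite eqxx mulr1 (subtree_compl tree (edge_und eiy)).
  have /(congr1 (fun m => m%:R : R)) := cardsC (B i y).
  rewrite natrD card_ord /G; set c := #|~: _|%:R; set b := #|B i y|%:R => <-.
  by ring.
rewrite /permutree_point mxE /descendants.
have -> : (\sum_(o <- children T i) subtree_size T i o)%:R = \sum_(o <- children T i) size o.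
  by rewrite natr_sum.
move: sum_size; rewrite -/size.
case: (parents T i) => [p|pl pr]; case: (children T i) => [c|cl cr];
  rewrite /= !big_cons !big_nil ?addr0 /G => eq_n;
  rewrite -[n%:R](subrK 1) -eq_n; by field.
Qed.

(** The factor 1/4 combines the 1/2 in the formula for the coordinates with the passage to ordered
    pairs, each edge separating 2 |B| (n - |B|) of them. *)
Lemma sum_permutree_point (I : {set 'I_n}) :
  \sum_(i in I) permutree_point R T 0 i = 'C(#|I|.+1, 2)%:R +
  (\sum_a \sum_c (((a \in I) != (c \in I))%:R - crossings I a c)) / 4.
Proof.
have binE m : 'C(m.+1, 2)%:R = m%:R * (m%:R + 1) / 2 :> R.
  have := mul_bin_diag m.+1 1; rewrite /= bin1 => /(congr1 (fun k => k%:R : R)).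
  by rewrite !natrM -natr1 mulrC => ->; field.
under [X in _ = _ + X / 4]eq_bigr => a _ do rewrite sumrB.
rewrite sumrB sum_separated sum_crossings card_ord binE.
under eq_bigr => i _ do rewrite permutree_pointE.
rewrite big_split /= sumr_const -mulr_sumr exchange_big /=.
set S := \sum_(p | edge T p.1 p.2) _ *+ 2.
set S' := \sum_(p | edge T p.1 p.2) _.
have -> : S = - (S' *+ 2).
  have ind z : \sum_(i in I) (z == i)%:R = (z \in I)%:R :> R.
    rewrite big_mkcond (bigD1 z) //= eqxx big1 ?addr0; first by case: (z \in I).
    by move=> i; rewrite eq_sym => /negPf ->; rewrite if_same.
  rewrite -sumrMnl -sumrN; apply: eq_bigr => p _; rewrite -mulr_sumr sumrB !ind.
  by rewrite /crossing; ring.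
by rewrite -[_ *+ #|I|]mulr_natr; field.
Qed.

End TreeInequality.

(** * Convex hull and polyhedron *)

Local Open Scope classical_set_scope.

Section Dotp.
Variables (R : realType) (n : nat).
Implicit Types x y z : 'rV[R]_n.

Lemma dotpC x y : dotp x y = dotp y x.
Proof. by apply: eq_bigr => i _; rewrite mulrC. Qed.

Lemma dotpDr x y z : dotp x (y + z) = dotp x y + dotp x z.
Proof. by rewrite -big_split; apply: eq_bigr => i _; rewrite mxE mulrDr. Qed.

Lemma dotpZr a x y : dotp x (a *: y) = a * dotp x y.
Proof. by rewrite mulr_sumr; apply: eq_bigr => i _; rewrite mxE mulrCA. Qed.

Lemma dotpNr x y : dotp x (- y) = - dotp x y.
Proof. by rewrite -scaleN1r dotpZr mulN1r. Qed.

Lemma dotpBr x y z : dotp x (y - z) = dotp x y - dotp x z.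
Proof. by rewrite dotpDr dotpNr. Qed.

Lemma dotp0r x : dotp x 0 = 0.
Proof. by rewrite -(scale0r 0) dotpZr mul0r. Qed.

Lemma dotp_sumr (I : Type) (r : seq I) (P : pred I) (F : I -> 'rV[R]_n) x :
  dotp x (\sum_(i <- r | P i) F i) = \sum_(i <- r | P i) dotp x (F i).
Proof. by apply: (big_morph (dotp x) (dotpDr x) (dotp0r x)). Qed.

Lemma dotpDl x y z : dotp (x + y) z = dotp x z + dotp y z.
Proof. by rewrite dotpC dotpDr !(dotpC z). Qed.

Lemma dotpZl a x y : dotp (a *: x) y = a * dotp x y.
Proof. by rewrite dotpC dotpZr dotpC. Qed.

Lemma dotpBl x y z : dotp (x - y) z = dotp x z - dotp y z.
Proof. by rewrite dotpC dotpBr !(dotpC z). Qed.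

Lemma dotp_suml (I : Type) (r : seq I) (P : pred I) (F : I -> 'rV[R]_n) x :
  dotp (\sum_(i <- r | P i) F i) x = \sum_(i <- r | P i) dotp (F i) x.
Proof. by rewrite dotpC dotp_sumr; apply: eq_bigr => i _; rewrite dotpC. Qed.

Lemma dotp_const a x : dotp (const_mx a) x = a * \sum_i x 0 i.
Proof. by rewrite mulr_sumr; apply: eq_bigr => i _; rewrite mxE. Qed.

Lemma dotp_delta x i : dotp x (delta_mx 0 i) = x 0 i.
Proof.
rewrite /dotp (bigD1 i) //= mxE !eqxx mulr1 big1 ?addr0 // => j /negPf ji.
by rewrite mxE ji andbF mulr0.
Qed.

Lemma dotp_gt0 x : x != 0 -> 0 < dotp x x.
Proof.
move=> x_neq0; have ge0 i : true -> 0 <= x 0 i * x 0 i by rewrite -expr2 sqr_ge0.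
rewrite lt_def sumr_ge0 // andbT; apply: contra x_neq0 => /eqP /(psumr_eq0P ge0) eq0.
apply/eqP/rowP => i; rewrite mxE; apply/eqP.
by have /eqP := eq0 i isT; rewrite mulf_eq0 orbb.
Qed.

End Dotp.

(** * Conic hulls and Farkas' lemma *)

Section ConicHull.
Variables (R : realType) (n : nat).
Implicit Types (A C : set 'rV[R]_n) (x y : 'rV[R]_n).

Lemma conic_hull_min A C : C 0 -> (forall x y, C x -> C y -> C (x + y)) ->
  (forall a x, 0 <= a -> C x -> C (a *: x)) -> A `<=` C -> conic_hull A `<=` C.
Proof.
move=> C0 CD CZ sAC x [m [p [w [Ap w_ge0 ->]]]].
by apply: (big_ind C) => // k _; apply: CZ (w_ge0 k) (sAC _ (Ap k)).
Qed.

Lemma conic_hull_mem A x : A x -> conic_hull A x.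
Proof.
move=> Ax; exists 1%N, (fun=> x), (fun=> 1); split=> //.
by rewrite big_ord1 scale1r.
Qed.

Lemma conic_hull0 A : conic_hull A 0.
Proof. by exists 0%N, (fun=> 0), (fun=> 0); split; try case; rewrite ?big_ord0. Qed.

Lemma conic_hullZ A a x : 0 <= a -> conic_hull A x -> conic_hull A (a *: x).
Proof.
move=> a_ge0 [m [p [w [Ap w_ge0 ->]]]]; exists m, p, (fun k => a * w k).
split=> // [k|]; first exact: mulr_ge0.
by rewrite scaler_sumr; apply: eq_bigr => k _; rewrite scalerA.
Qed.

Lemma conic_hullD A x y : conic_hull A x -> conic_hull A y -> conic_hull A (x + y).
Proof.
move=> [m [p [w [Ap w_ge0 ->]]]] [m' [p' [w' [Ap' w'_ge0 ->]]]].
exists (m + m')%N, (fun k => match split k with inl i => p i | inr i => p' i end),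
  (fun k => match split k with inl i => w i | inr i => w' i end).
split=> [k|k|]; [by case: split|by case: split|].
rewrite big_split_ord /=; congr (_ + _); apply: eq_bigr => k _.
  by rewrite (unsplitK (inl k)).
by rewrite (unsplitK (inr k)).
Qed.

Lemma conic_hull_sum A (I : finType) (P : pred I) (F : I -> 'rV[R]_n) :
  (forall i, P i -> conic_hull A (F i)) -> conic_hull A (\sum_(i | P i) F i).
Proof.
by move=> AF; apply: (big_ind (conic_hull A)) => //;
  [apply: conic_hull0|apply: conic_hullD].
Qed.

Lemma conic_hullS A C : A `<=` C -> conic_hull A `<=` conic_hull C.
Proof. by move=> sAC x [m [p [w [Ap w0 ->]]]]; exists m, p, w; split=> // k; apply: sAC. Qed.

(* If the functional c separating b from the first generators is positive on the
   last one v, project everything along v onto the kernel of c. *)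
Lemma farkas (s : seq 'rV[R]_n) b : conic_hull [set x | x \in s] b \/
  exists c, (forall x, x \in s -> dotp c x <= 0) /\ 0 < dotp c b.
Proof.
have [m] := ubnP (size s); elim: m s b => // m IHm [|v s] b.
  have [->|/dotp_gt0 b_gt0] := eqVneq b 0; first by left; apply: conic_hull0.
  by right; exists b.
rewrite ltnS => /= szs.
have sub_s : [set x | x \in s] `<=` [set x | x \in v :: s].
  by move=> x /= xs; rewrite inE xs orbT.
have [hull|[c [c_s c_b]]] := IHm s b szs; first by left; apply: conic_hullS sub_s _ hull.
have [c_v|c_v] := lerP (dotp c v) 0.
  by right; exists c; split=> // x; rewrite inE => /orP [/eqP ->|/c_s].
pose proj x := x - (dotp c x / dotp c v) *: v.
have [|hull|[c' [c'_s c'_b]]] := IHm (map proj s) (proj b); first by rewrite size_map.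
  left; have v_hull : conic_hull [set x | x \in v :: s] v.
    by apply: conic_hull_mem; rewrite /= mem_head.
  rewrite -(subrK ((dotp c b / dotp c v) *: v) b); apply: conic_hullD; last first.
    by apply: conic_hullZ v_hull; rewrite divr_ge0 // ltW.
  apply: conic_hull_min hull => [|||_ /mapP [x xs ->]].
  - exact: conic_hull0.
  - exact: conic_hullD.
  - exact: conic_hullZ.
  rewrite /proj -scaleNr; apply: conic_hullD.
    by apply/conic_hull_mem/sub_s.
  apply: conic_hullZ v_hull; rewrite -mulNr divr_ge0 ?(ltW c_v) // oppr_ge0.
  exact: c_s.
right; exists (c' - (dotp c' v / dotp c v) *: c).
have proj_dot x : dotp (c' - (dotp c' v / dotp c v) *: c) x = dotp c' (proj x).
  by rewrite dotpBl dotpZl dotpBr dotpZr; ring.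
have proj_v : proj v = 0 by rewrite /proj divff ?gt_eqF // scale1r subrr.
split=> [x|]; rewrite proj_dot //.
rewrite inE => /orP [/eqP ->|xs]; first by rewrite proj_v dotp0r.
by apply: c'_s; apply: map_f.
Qed.

End ConicHull.

(** * The inequalities at a(T) and the dual bases of a permutree *)

Section PermutreePolyhedron.
Variables (R : realType) (n : nat).
Implicit Types (T : permutree n) (c v x y : 'rV[R]_n).
Local Notation pt := (permutree_point R).

Lemma rowB x y k : (x - y) 0 k = x 0 k - y 0 k.
Proof. by rewrite !mxE. Qed.

Lemma ord_natr_neq0 (i : 'I_n) : n%:R != 0 :> R.
Proof. by rewrite pnatr_eq0 -lt0n (leq_ltn_trans _ (ltn_ord i)). Qed.

Lemma sum_permutree_point_ge T (I : {set 'I_n}) : admissible (decoration T) I ->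
  'C(#|I|.+1, 2)%:R <= \sum_(i in I) pt T 0 i.
Proof.
move=> admI; rewrite sum_permutree_point lerDl divr_ge0 //.
apply: sumr_ge0 => a _; apply: sumr_ge0 => c _.
by rewrite subr_ge0; apply: crossings_le.
Qed.

Lemma sum_permutree_point_tight T (I : {set 'I_n}) : admissible (decoration T) I ->
  (exists i j, i \in I /\ j \notin I) ->
  \sum_(i in I) pt T 0 i = 'C(#|I|.+1, 2)%:R ->
  exists i j, edge T i j /\ I = subtree_through (edge T) j i.
Proof.
move=> admI propI /eqP; rewrite sum_permutree_point -subr_eq0 addrAC subrr add0r.
rewrite mulf_eq0 invr_eq0 pnatr_eq0 orbF => /eqP sum0.
apply: (@tight_edge_cut R) => // a c; apply/eqP; rewrite eq_sym -subr_eq0; apply/eqP.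
have ge0 (a' c' : 'I_n) : 0 <= ((a' \in I) != (c' \in I))%:R - crossings R T I a' c'.
  by rewrite subr_ge0; apply: crossings_le.
have row0 : \sum_c' (((a \in I) != (c' \in I))%:R - crossings R T I a c') = 0.
  by apply: (psumr_eq0P _ sum0) => // a' _; apply: sumr_ge0.
exact: (psumr_eq0P _ row0).
Qed.

Lemma crossing_edge_cut T i j p : edge T i j -> edge T p.1 p.2 ->
  crossing R (subtree_through (edge T) j i) p = (p == (i, j))%:R.
Proof.
move=> eij ep; have uji := edge_und' eij; rewrite /crossing.
have neq_ji := und_neq (permutree_tree T) uji.
have [->|neq_p] /= := eqVneq.
  by rewrite mem_subtree_root (negPf (subtree_self (edge T) neq_ji)) subr0.
rewrite (subtree_adj (permutree_tree T) uji (edge_und ep)) ?subrr //.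
rewrite negb_or; apply/andP; split; last first.
  by apply: contra neq_p => /andP [/eqP <- /eqP <-]; rewrite -surjective_pairing.
apply: contraL ep => /andP [/eqP -> /eqP ->].
by have [asym _ _] := permutree_tree T; apply: asym.
Qed.

Lemma sum_permutree_point_edge T i j : edge T i j ->
  let I := subtree_through (edge T) j i in
  \sum_(k in I) pt T 0 k = 'C(#|I|.+1, 2)%:R.
Proof.
move=> eij /=; rewrite sum_permutree_point big1 ?mul0r ?addr0 // => a _.
apply: big1 => c _; rewrite /crossings (bigD1 (i, j)) //= big1; last first.
  by move=> p /andP [ep /negPf neq_p]; rewrite crossing_edge_cut // neq_p mul0r.
by rewrite crossing_edge_cut // eqxx mul1r addr0 subrr.
Qed.

Lemma permutree_point_hyperplane T : perm_hyperplane (pt T).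
Proof.
have := @sum_permutree_point R n T [set: 'I_n]%SET; rewrite [X in _ + X / _]big1 => [|a _].
  rewrite mul0r addr0 cardsT card_ord /perm_hyperplane /= => <-; apply: eq_bigl => i.
  by rewrite finset.in_setT.
apply: big1 => c _; rewrite !finset.in_setT eqxx sub0r; apply/eqP.
rewrite oppr_eq0 /crossings big1 // => p _.
by rewrite /crossing !finset.in_setT subrr mul0r.
Qed.

Lemma permutree_point_polyhedron T : permutree_polyhedron R (decoration T) (pt T).
Proof.
split; first exact: permutree_point_hyperplane.
by move=> B /building_block_admissible; apply: sum_permutree_point_ge.
Qed.

Lemma permutree_point_int T i : pt T 0 i \is a Num.int.
Proof.
rewrite mxE; case: (parents T i) => [?|? ?]; case: (children T i) => [?|? ?];
  rewrite ?(rpredB, rpredD, rpredM, rpred1, rpred_nat) //.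
Qed.

Definition edge_dir (p : 'I_n * 'I_n) : 'rV[R]_n :=
  delta_mx 0 p.2 - delta_mx 0 p.1.

Definition edge_normal T (p : 'I_n * 'I_n) : 'rV[R]_n :=
  let I := subtree_through (edge T) p.2 p.1 in
  \row_k (#|I|%:R / n%:R - (k \in I)%:R).

Lemma dotp_dir v p : dotp v (edge_dir p) = v 0 p.2 - v 0 p.1.
Proof. by rewrite dotpBr !dotp_delta. Qed.

Lemma sum_dir p : \sum_k edge_dir p 0 k = 0.
Proof.
have := dotp_const 1 (edge_dir p).
by rewrite mul1r => <-; rewrite dotp_dir !mxE subrr.
Qed.

Lemma sum_normal T p : \sum_k edge_normal T p 0 k = 0.
Proof.
under eq_bigr => k _ do rewrite mxE.
rewrite sumrB sum_indicator sumr_const card_ord -(mulr_natr (_ / _)) mulfVK ?subrr //.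
exact: ord_natr_neq0 p.1.
Qed.

Lemma dotp_normal T p v : \sum_k v 0 k = 0 ->
  dotp (edge_normal T p) v = - \sum_(k in subtree_through (edge T) p.2 p.1) v 0 k.
Proof.
move=> v0; rewrite /dotp; under eq_bigr => k _ do rewrite mxE mulrBl.
rewrite sumrB -mulr_sumr v0 mulr0 sub0r; congr (- _).
rewrite [RHS]big_mkcond; apply: eq_bigr => k _.
by case: (k \in _); rewrite ?mul1r ?mul0r.
Qed.

Lemma dotp_normal_dir T p q : edge T p.1 p.2 -> edge T q.1 q.2 ->
  dotp (edge_normal T p) (edge_dir q) = (q == p)%:R.
Proof.
move=> ep eq; rewrite dotp_dir !mxE opprB addrC addrA subrK.
by rewrite -/(crossing R _ q) crossing_edge_cut // -surjective_pairing.
Qed.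

(** The difference [w] of the two sides is orthogonal to every edge direction, hence constant along
    the connected tree; its coordinates also sum to zero. *)
Lemma edge_decomposition T v : v = const_mx ((\sum_k v 0 k) / n%:R) +
  \sum_(p : 'I_n * 'I_n | edge T p.1 p.2) dotp v (edge_dir p) *: edge_normal T p.
Proof.
set m := const_mx _; set S := \sum_(p | edge T _ _) _; pose w := v - m - S.
suff w0 k : w 0 k = 0.
  by apply/rowP => k; have /eqP := w0 k; rewrite !mxE !subr_eq add0r addrC => /eqP.
have w_dir p : edge T p.1 p.2 -> dotp w (edge_dir p) = 0.
  move=> ep; rewrite !dotpBl dotp_const sum_dir mulr0 subr0 dotp_suml (bigD1 p) //=.
  rewrite dotpZl dotp_normal_dir // eqxx mulr1 big1 ?addr0 ?subrr // => q /andP [eq neq_q].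
  by rewrite dotpZl dotp_normal_dir // eq_sym (negPf neq_q) mulr0.
have w_const k' : w 0 k = w 0 k'.
  have [_ conn _] := permutree_tree T; apply/eqP.
  apply: (connect_invariant (A := fun k' => w 0 k == w 0 k') _ (conn k k')) => //.
  move=> x y uxy /eqP ->; case/orP: uxy => exy.
    by have /eqP := w_dir (x, y) exy; rewrite dotp_dir subr_eq0 eq_sym.
  by have /eqP := w_dir (y, x) exy; rewrite dotp_dir subr_eq0.
have n_neq0 := ord_natr_neq0 k.
have sum_w : \sum_k' w 0 k' = 0.
  rewrite -[LHS]mul1r -dotp_const !dotpBr dotp_sumr big1 => [|p _]; last first.
    by rewrite dotpZr dotp_const sum_normal !mulr0.
  rewrite !dotp_const !mul1r subr0; under [X in _ - X]eq_bigr => i _ do rewrite mxE.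
  by rewrite sumr_const card_ord -(mulr_natr (_ / _)) mulfVK // subrr.
have : w 0 k *+ n = 0.
  by rewrite -sum_w (eq_bigr (fun=> w 0 k)) ?sumr_const ?card_ord.
by move/eqP; rewrite -mulr_natr mulf_eq0 (negPf n_neq0) orbF => /eqP.
Qed.

Lemma dotp_edges T v x : \sum_k x 0 k = 0 -> dotp v x =
  \sum_(p : 'I_n * 'I_n | edge T p.1 p.2)
    dotp v (edge_dir p) * dotp (edge_normal T p) x.
Proof.
move=> x0; rewrite {1}(edge_decomposition T v) dotpDl dotp_const x0 mulr0 add0r.
by rewrite dotp_suml; apply: eq_bigr => p _; rewrite dotpZl.
Qed.

Lemma edge_decomposition_dual T x : \sum_k x 0 k = 0 ->
  x = \sum_(p : 'I_n * 'I_n | edge T p.1 p.2)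
    dotp (edge_normal T p) x *: edge_dir p.
Proof.
move=> x0; apply/rowP => k; rewrite -!dotp_delta dotpC (dotp_edges T _ x0).
rewrite dotpC dotp_sumr; apply: eq_bigr => p _; rewrite dotpZr.
by rewrite mulrC.
Qed.

Section FixedDecoration.
Variable delta : n.-tuple symbol.
Local Notation Q := (permutree_polyhedron R delta).

Lemma polyhedron_sum x y : Q x -> Q y -> \sum_k (x - y) 0 k = 0.
Proof.
move=> [xH _] [yH _]; under eq_bigr => k _ do rewrite rowB.
by rewrite sumrB xH yH subrr.
Qed.

Lemma point_polyhedron T : decoration T = delta -> Q (pt T).
Proof. by move=> <-; apply: permutree_point_polyhedron. Qed.

Lemma normal_max T p x : decoration T = delta -> edge T p.1 p.2 -> Q x ->
  0 <= dotp (edge_normal T p) (pt T - x).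
Proof.
move=> dT ep Qx; rewrite dotp_normal; last first.
  exact: polyhedron_sum (point_polyhedron dT) Qx.
under eq_bigr => k _ do rewrite rowB.
rewrite sumrB.
have -> : \sum_(k in subtree_through (edge T) p.2 p.1) pt T 0 k =
  'C(#|subtree_through (edge T) p.2 p.1|.+1, 2)%:R by apply: sum_permutree_point_edge.
rewrite opprB subr_ge0; case: Qx => _; apply.
exists T; split=> //; exists p.1, p.2; split=> //.
by rewrite (source_sideE (permutree_tree T)).
Qed.

(** In the dual bases the difference of the two values is a sum of products: the increase of [c]
    along an edge times the slack of [x] in the inequality of that edge. *)
Lemma cone_max T c x : decoration T = delta ->
  (forall i j, edge T i j -> c 0 i <= c 0 j) -> Q x -> dotp c x <= dotp c (pt T).
Proof.
move=> dT cT Qx; rewrite -subr_ge0 -dotpBr.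
rewrite (dotp_edges T c (polyhedron_sum (point_polyhedron dT) Qx)).
apply: sumr_ge0 => p ep; apply: mulr_ge0; last exact: normal_max.
by rewrite dotp_dir subr_ge0; apply: cT.
Qed.

(** The sum over a block drops, by 1, only if the edge [p] enters the block upwards. Such a block is
    not an edge cut of [T], so its inequality is not tight at a(T), and integrality gives a slack of
    at least 1. *)
Lemma polyhedron_neighbor T p : decoration T = delta -> edge T p.1 p.2 ->
  Q (pt T - edge_dir p).
Proof.
move=> dT ep; have [ptH ptB] := point_polyhedron dT; split.
  rewrite /perm_hyperplane /=; under eq_bigr => k _ do rewrite rowB.
  by rewrite sumrB sum_dir subr0.
move=> B blockB; have := ptB B blockB; rewrite /perm_halfspace /=.
set C := 'C(_, _)%:R; set S := \sum_(k in B) pt T 0 k => ge_S.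
have ind z : \sum_(k in B) (delta_mx 0 z : 'rV[R]_n) 0 k = (z \in B)%:R.
  rewrite big_mkcond (bigD1 z) //= mxE !eqxx big1 ?addr0; first by case: (z \in B).
  by move=> k /negPf kz; rewrite mxE kz andbF if_same.
have -> : \sum_(k in B) (pt T - edge_dir p) 0 k = S - ((p.2 \in B)%:R - (p.1 \in B)%:R).
  by rewrite -!ind -!sumrB; apply: eq_bigr => k _; rewrite !rowB.
have [p2B|p2B] := boolP (p.2 \in B); last first.
  by rewrite sub0r opprK (le_trans ge_S) // lerDl ler0n.
have [p1B|p1B] := boolP (p.1 \in B); first by rewrite subrr subr0.
rewrite subr0 lerBrDr.
have neq_S : C != S.
  apply/eqP => eq_S; have := building_block_admissible blockB; rewrite -dT => admB.
  have [i [j [eij eqB]]] :=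
    sum_permutree_point_tight admB (building_block_proper blockB) (esym eq_S).
  have := crossing_edge_cut eij ep; rewrite -eqB /crossing p2B (negPf p1B) /=.
  by case: (_ == _) => /=; lra.
have /intrP [z Sz] : S \is a Num.int.
  by apply: rpred_sum => k _; apply: permutree_point_int.
have : C < S by rewrite lt_def eq_sym neq_S.
rewrite Sz /C pmulrn ltr_int -[X in _ + X]/(1%:~R) -intrD ler_int.
by lia.
Qed.

Lemma hull_sub_polyhedron : permutree_hull R delta `<=` Q.
Proof.
move=> x [m [p [w [Ap w_ge0 w1 ->]]]].
have Qp k : Q (p k) by have [T dT <-] := Ap k; apply: point_polyhedron.
have sum_comb (P : pred 'I_n) : \sum_(i | P i) (\sum_(k < m) w k *: p k) 0 i =
    \sum_(k < m) w k * \sum_(i | P i) p k 0 i.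
  under eq_bigr => i _ do rewrite summxE.
  rewrite exchange_big; apply: eq_bigr => k _; rewrite mulr_sumr.
  by apply: eq_bigr => i _; rewrite mxE.
split.
  rewrite /perm_hyperplane /= sum_comb.
  under eq_bigr => k _ do rewrite (Qp k).1.
  by rewrite -mulr_suml w1 mul1r.
move=> B blockB; rewrite /perm_halfspace /= sum_comb.
have -> : 'C(#|B|.+1, 2)%:R = \sum_(k < m) w k * 'C(#|B|.+1, 2)%:R.
  by rewrite -mulr_suml w1 mul1r.
apply: ler_sum => k _; have [_ /(_ B blockB) ge_C] := Qp k.
exact: ler_wpM2l.
Qed.

(** By [permutree_pointE] the point depends only on the set of edges, of which there are finitely
    many. *)
Lemma permutree_points_finite :
  finite_set [set permutree_point R T | T in [set T | decoration T = delta]].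
Proof.
pose e (E : {set 'I_n * 'I_n}) := [rel x y | (x, y) \in E].
pose f (E : {set 'I_n * 'I_n}) : 'rV[R]_n := \row_i ((n%:R + 1) / 2 +
  2^-1 * \sum_(p : 'I_n * 'I_n | e E p.1 p.2)
    #|subtree_through (e E) p.2 p.1|%:R *
    (n%:R - #|subtree_through (e E) p.2 p.1|%:R) * ((p.2 == i)%:R - (p.1 == i)%:R)).
apply: (@sub_finite_set _ _ (f @` [set: {set 'I_n * 'I_n}])).
  move=> _ [T _ <-]; pose E := [set p | edge T p.1 p.2]%SET.
  exists E => //; apply/rowP => i; rewrite mxE permutree_pointE.
  have eE (k k' : 'I_n) : e E k k' = edge T k k' by rewrite /= inE.
  congr (_ + _ * _); apply: eq_big => [p|p _]; first exact: eE.
  rewrite (@eq_subtree_through _ (e E) (edge T)) // => x y.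
  by rewrite /undirected /= !inE.
by apply: finite_image; apply: finite_finset.
Qed.

Lemma hull_polyhedron : permutree_hull R delta = Q.
Proof.
apply/seteqP; split; first exact: hull_sub_polyhedron.
move=> x Qx; have [T0 [dT0 _]] := permutree_extension delta (fun=> 0 : R).
(* For n = 0 the constant of the hyperplane is 0 and cannot normalize the weights below, but all
   vectors coincide. *)
have [n_eq0|n_gt0] := posnP n.
  exists 1%N, (fun=> x), (fun=> 1); split=> //; rewrite ?big_ord1 ?scale1r //.
  move=> _; exists T0 => //; apply/rowP => i.
  by have := ltn_ord i; rewrite {2}n_eq0.
have /finite_seqP [s eq_s] := permutree_points_finite.
rewrite /permutree_hull eq_s.
have pt_s T : decoration T = delta -> pt T \in s.
  by move=> dT; have: [set` s] (pt T) by rewrite -eq_s; exists T.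
have [[m [p [w [sp w_ge0 eq_x]]]]|[c [c_s c_x]]] := farkas s x; last first.
  (* The separating functional [c] is maximal over the polyhedron at the point of a permutree whose
     edges it respects; yet it is nonpositive there and positive at [x]. *)
  have [T [dT cT]] := permutree_extension delta (c 0).
  have := c_s _ (pt_s T dT); rewrite leNgt => /negP []; apply: lt_le_trans c_x _.
  exact: cone_max.
exists m, p, w; split=> //.
(* Since [x] and the points lie on one hyperplane with nonzero constant, the weights of the conic
   combination sum to 1. *)
have N_neq0 : 'C(n.+1, 2)%:R != 0 :> R by rewrite pnatr_eq0 -lt0n bin_gt0.
apply: (mulIf N_neq0); rewrite mul1r -[in RHS](Qx.1) eq_x mulr_suml.
under [RHS]eq_bigr => i _ do rewrite summxE.
rewrite exchange_big; apply: eq_bigr => k _.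
under eq_bigr => i _ do rewrite mxE.
rewrite -mulr_sumr; congr (_ * _).
have : [set` s] (p k) by apply: sp.
by rewrite -eq_s => -[T _ <-]; rewrite [RHS]permutree_point_hyperplane.
Qed.

Lemma hull_polytope : polytope (permutree_hull R delta).
Proof. by eexists; first exact: permutree_points_finite. Qed.

End FixedDecoration.
End PermutreePolyhedron.

(** * Normal fan *)

Section ConeFaces.
Variables (R : realType) (n : nat) (T : permutree n).
Implicit Types (c v x y : 'rV[R]_n) (p q : 'I_n * 'I_n) (S : {set 'I_n * 'I_n}).
Local Notation center := (perm_center R n).
Local Notation E := [set p | edge T p.1 p.2]%SET.

(** The cone is simplicial with apex [perm_center] and one ray per edge, spanned by its normal; this
    is the face spanned by the rays of [S]. *)
Definition cone_face S : set 'rV[R]_n := [set x | permutree_cone T x /\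
  forall p, edge T p.1 p.2 -> p \notin S -> dotp x (edge_dir R p) = 0].

Lemma center_hyperplane : perm_hyperplane center.
Proof.
rewrite /perm_hyperplane /=; under eq_bigr => i _ do rewrite mxE.
rewrite sumr_const card_ord; have := mul_bin_diag n.+1 1.
rewrite /= bin1 => /(congr1 (fun k => k%:R : R)); rewrite !natrM => eq_n.
by apply: (mulfI (x := 2)); rewrite ?pnatr_eq0 // -eq_n -(mulr_natr (_ / _)); field.
Qed.

Lemma dotp_center_dir p : dotp center (edge_dir R p) = 0.
Proof. by rewrite dotp_const sum_dir mulr0. Qed.

Lemma permutree_coneP x : permutree_cone T x <->
  \sum_k (x - center) 0 k = 0 /\
  forall p, edge T p.1 p.2 -> 0 <= dotp x (edge_dir R p).
Proof.
have sum_center : \sum_k center 0 k = 'C(n.+1, 2)%:R by exact: center_hyperplane.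
have eq_sum : \sum_k (x - center) 0 k = \sum_k x 0 k - 'C(n.+1, 2)%:R.
  by under eq_bigr => k _ do rewrite rowB; rewrite sumrB sum_center.
rewrite eq_sum; split=> [[xH x_le]|[/eqP + x_ge]].
  by split=> [|p ep]; [rewrite xH subrr|rewrite dotp_dir subr_ge0 x_le].
rewrite subr_eq0 => /eqP xH; split=> // i j eij.
by rewrite -subr_ge0; have := x_ge (i, j) eij; rewrite dotp_dir.
Qed.

Lemma permutree_cone_center : permutree_cone T center.
Proof.
apply/permutree_coneP; rewrite subrr; split=> [|p _]; last by rewrite dotp_center_dir.
by apply: big1 => k _; rewrite mxE.
Qed.

Lemma cone_decomposition x : permutree_cone T x -> x - center =
  \sum_(p | edge T p.1 p.2) dotp x (edge_dir R p) *: edge_normal R T p.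
Proof.
case/permutree_coneP => x0 _; rewrite {1}(edge_decomposition T (x - center)) x0.
rewrite mul0r; have -> : const_mx 0 = 0 :> 'rV[R]_n by apply/rowP => i; rewrite !mxE.
rewrite add0r; apply: eq_bigr => p _.
by rewrite dotpBl dotp_center_dir subr0.
Qed.

Lemma permutree_cone_add x p a : permutree_cone T x -> edge T p.1 p.2 -> 0 <= a ->
  permutree_cone T (x + a *: edge_normal R T p).
Proof.
move=> /permutree_coneP [x0 x_ge] ep a_ge0; apply/permutree_coneP; split=> [|q eq].
  rewrite addrAC -[LHS]mul1r -dotp_const dotpDr dotpZr !dotp_const.
  by rewrite x0 sum_normal !mulr0 addr0.
rewrite dotpDl dotpZl dotp_normal_dir //; apply: addr_ge0; first exact: x_ge.
exact: mulr_ge0.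
Qed.

Lemma cone_face_is_face S : face (permutree_cone T) (cone_face S).
Proof.
split.
  exists center; split; first exact: permutree_cone_center.
  by move=> p _ _; apply: dotp_center_dir.
(* Relative to its value 0 at the apex, this functional is nonpositive on the cone and vanishes
   exactly where all edges outside [S] are tight. *)
pose c : 'rV[R]_n := - \sum_(p | edge T p.1 p.2 && (p \notin S)) edge_dir R p.
have cE x : dotp c x = - \sum_(p | edge T p.1 p.2 && (p \notin S)) dotp x (edge_dir R p).
  by rewrite dotpC dotpNr dotp_sumr.
have term_ge0 x : permutree_cone T x ->
    forall p, edge T p.1 p.2 && (p \notin S) -> 0 <= dotp x (edge_dir R p).
  by move=> /permutree_coneP [_ x_ge] p /andP [ep _]; apply: x_ge.
exists c; apply/seteqP; split=> x [Cx].
  move=> x0; split=> // y Cy; rewrite !cE [X in _ <= - X]big1; last first.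
    by move=> p /andP [ep pS]; apply: x0.
  by rewrite oppr0 oppr_le0; apply: sumr_ge0; apply: term_ge0.
move=> /(_ _ permutree_cone_center); rewrite !cE [X in - X <= _]big1; last first.
  by move=> p _; apply: dotp_center_dir.
rewrite oppr0 oppr_ge0 => le0; split=> // p ep pS.
apply: (psumr_eq0P (term_ge0 _ Cx)); last by rewrite ep.
by apply/eqP; rewrite eq_le le0; apply: sumr_ge0; apply: term_ge0.
Qed.

Lemma face_is_cone_face C : face (permutree_cone T) C -> exists S, C = cone_face S.
Proof.
case=> [[x0 Cx0] [c eqC]]; exists [set p | dotp c (edge_normal R T p) == 0]%SET.
move: Cx0; rewrite {}eqC => -[Cx0 max0].
(* Moving from a maximizer along a ray stays in the cone, so [c] cannot increase; hence the apex is
   a maximizer too, and the face is spanned by the rays on which [c] vanishes. *)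
have le0 p : edge T p.1 p.2 -> dotp c (edge_normal R T p) <= 0.
  move=> ep; have := max0 _ (permutree_cone_add Cx0 ep ler01).
  by rewrite scale1r dotpDr gerDl.
have dotE x : permutree_cone T x -> dotp c center - dotp c x =
    \sum_(p | edge T p.1 p.2) dotp x (edge_dir R p) * - dotp c (edge_normal R T p).
  move=> Cx; rewrite -[LHS]opprB -dotpBr (cone_decomposition Cx) dotp_sumr -sumrN.
  by apply: eq_bigr => p _; rewrite dotpZr mulrN.
have term_ge0 x : permutree_cone T x -> forall p, edge T p.1 p.2 ->
    0 <= dotp x (edge_dir R p) * - dotp c (edge_normal R T p).
  move=> /permutree_coneP [_ x_ge] p ep; apply: mulr_ge0; first exact: x_ge.
  by rewrite oppr_ge0 le0.
have center_max x : permutree_cone T x -> dotp c x <= dotp c center.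
  by move=> Cx; rewrite -subr_ge0 dotE //; apply: sumr_ge0; apply: term_ge0.
apply/seteqP; split=> x [Cx].
  move=> maxx; split=> // p ep; rewrite inE => cp.
  have /eqP : dotp x (edge_dir R p) * - dotp c (edge_normal R T p) = 0.
    apply: (psumr_eq0P (term_ge0 _ Cx)) => //; rewrite -dotE //.
    apply/eqP; rewrite subr_eq0 eq_le center_max // andbT.
    exact: maxx permutree_cone_center.
  by rewrite mulf_eq0 oppr_eq0 (negPf cp) orbF => /eqP.
move=> x_off; split=> // y Cy; apply: le_trans (center_max _ Cy) _.
rewrite -subr_le0 dotE // big1 // => p ep.
have [/eqP ->|cp] := boolP (dotp c (edge_normal R T p) == 0).
  by rewrite oppr0 mulr0.
by rewrite x_off ?inE // mul0r.
Qed.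

End ConeFaces.

(** * Facets at a(T) and normal cones *)

Section NormalCones.
Variables (R : realType) (n : nat) (delta : n.-tuple symbol) (T : permutree n).
Hypothesis dT : decoration T = delta.
Implicit Types (c v x y : 'rV[R]_n) (p q : 'I_n * 'I_n) (S : {set 'I_n * 'I_n}).
Local Notation center := (perm_center R n).
Local Notation Q := (permutree_polyhedron R delta).
Local Notation a := (permutree_point R T).

Lemma edges_free S : (forall p, p \in S -> edge T p.1 p.2) ->
  row_free (\matrix_(k < #|S|) - edge_dir R (enum_val k)).
Proof.
move=> SE; apply/row_freeP.
exists (\matrix_(k < #|S|) - edge_normal R T (enum_val k))^T.
apply/matrixP => k l; rewrite !mxE.
have -> : \sum_j (\matrix_(k0 < #|S|) - edge_dir R (enum_val k0)) k j *
    (\matrix_(k0 < #|S|) - edge_normal R T (enum_val k0))^T j l =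
    dotp (edge_normal R T (enum_val l)) (edge_dir R (enum_val k)).
  by apply: eq_bigr => j _; rewrite !mxE mulrNN mulrC.
rewrite dotp_normal_dir ?SE ?enum_valP //.
by rewrite (inj_eq enum_val_inj).
Qed.

(** The neighbors a(T) - u_p, for [p] in [S], supply the affinely independent points; the last
    hypothesis kills all other coordinates in the basis of edge directions. *)
Lemma has_dim_edges (P : set 'rV[R]_n) S : (forall p, p \in S -> edge T p.1 p.2) ->
  P a -> (forall p, p \in S -> P (a - edge_dir R p)) ->
  (forall x, P x -> Q x /\ forall p, edge T p.1 p.2 -> p \notin S ->
     dotp (edge_normal R T p) (x - a) = 0) ->
  has_dim P #|S|.
Proof.
move=> SE Pa Pdir Pspan; exists a, (\matrix_(k < #|S|) - edge_dir R (enum_val k)).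
split=> // [k||x Px].
- by rewrite rowK; apply/Pdir/enum_valP.
- exact: edges_free.
have [Qx x_off] := Pspan _ Px.
rewrite (edge_decomposition_dual T (polyhedron_sum Qx (point_polyhedron R dT))).
apply: summx_sub => p ep; have [pS|pS] := boolP (p \in S); last first.
  by rewrite x_off // scale0r sub0mx.
apply: scalemx_sub; rewrite -[edge_dir R p]opprK -scaleN1r scalemx_sub //.
rewrite -(enum_rankK_in pS pS) -[- _](rowK (fun k => - edge_dir R (enum_val k))).
exact: row_sub.
Qed.

Lemma normal_maximizers p : edge T p.1 p.2 -> maximizers Q (edge_normal R T p) a.
Proof.
move=> ep; split=> [|y Qy]; first exact: point_polyhedron.
by rewrite -subr_ge0 -dotpBr; exact: normal_max dT ep Qy.
Qed.

Lemma normal_facet p : edge T p.1 p.2 ->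
  facet Q (maximizers Q (edge_normal R T p)).
Proof.
move=> ep; have aG := normal_maximizers ep.
split; first by split; [exists a|eexists].
pose E := [set q | edge T q.1 q.2]%SET.
have EP q : (q \in E) = edge T q.1 q.2 by rewrite inE.
(* The facet keeps the neighbors of a(T) along all edges but [p], whose direction alone is not
   orthogonal to the normal. *)
exists #|E :\ p|; split.
  have : has_dim Q #|E|.
    apply: has_dim_edges => [q||q|x Qx].
    - by rewrite EP.
    - exact: point_polyhedron.
    - by rewrite EP; apply: polyhedron_neighbor.
    - by split=> // q eq; rewrite EP eq.
  by rewrite (cardsD1 p) EP ep.
apply: has_dim_edges => [q||q|x [Qx xmax]] //.
- by rewrite !inE => /andP [].
- rewrite !inE => /andP [neq_qp eq]; split; first exact: polyhedron_neighbor.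
  move=> y Qy; rewrite dotpBr dotp_normal_dir // (negPf neq_qp) subr0.
  exact: aG.2.
split=> // q eq; rewrite !inE eq andbT negbK => /eqP ->.
by rewrite dotpBr; apply/eqP; rewrite subr_eq0 eq_le aG.2 // xmax //; case: aG.
Qed.

Lemma max_at_point v p : maximizers Q v a -> edge T p.1 p.2 ->
  0 <= dotp v (edge_dir R p).
Proof.
case=> _ maxa ep; have := maxa _ (polyhedron_neighbor R dT ep).
by rewrite dotpBr gerBl.
Qed.

Lemma conic_hull_normals S x : cone_face T S x ->
  conic_hull [set edge_normal R T p | p in [set p | edge T p.1 p.2 /\ p \in S]]
    (x - center).
Proof.
case=> Cx x_off; rewrite (cone_decomposition Cx).
apply: conic_hull_sum => p ep; have [pS|pS] := boolP (p \in S); last first.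
  by rewrite x_off // scale0r; apply: conic_hull0.
apply: conic_hullZ; first by have [_] := (permutree_coneP _ _).1 Cx; apply.
by apply: conic_hull_mem; exists p.
Qed.

Section Face.
Variables (S : {set 'I_n * 'I_n}) (c : 'rV[R]_n).
Hypothesis c_in : forall p, edge T p.1 p.2 -> p \in S -> 0 < dotp c (edge_dir R p).
Hypothesis c_off : forall p, edge T p.1 p.2 -> p \notin S -> dotp c (edge_dir R p) = 0.
Local Notation F := (maximizers Q c).

Let c_ge0 p : edge T p.1 p.2 -> 0 <= dotp c (edge_dir R p).
Proof.
by move=> ep; have [/(c_in ep)/ltW|/(c_off ep) ->] := boolP (p \in S).
Qed.

Lemma point_in_face : F a.
Proof.
split=> [|y Qy]; first exact: point_polyhedron.
apply: (cone_max dT) => // i j eij.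
by rewrite -subr_ge0; have := c_ge0 (p := (i, j)) eij; rewrite dotp_dir.
Qed.

(** For [x] in the face, the sum of [dotp_edges] for a(T) - x has nonnegative terms and vanishes;
    the coefficient at [p] is positive, so the slack at [p] is zero. *)
Lemma face_sub_facet p : edge T p.1 p.2 -> p \in S ->
  F `<=` maximizers Q (edge_normal R T p).
Proof.
move=> ep pS x [Qx maxx]; split=> // y Qy.
have Qa := point_polyhedron R dT.
have : dotp c (a - x) = 0.
  by apply/eqP; rewrite dotpBr subr_eq0 eq_le maxx // (point_in_face).2.
rewrite (dotp_edges T c (polyhedron_sum Qa Qx)) => /psumr_eq0P sum0.
have /eqP := sum0 (fun q eq => mulr_ge0 (c_ge0 eq) (normal_max dT eq Qx)) p ep.
rewrite mulf_eq0 gt_eqF ?c_in //= dotpBr subr_eq0 => /eqP <-.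
exact: (normal_maximizers ep).2.
Qed.

(** The conditions on [c] place it in the relative interior of the face spanned by [S]. The normals
    of the edges in [S] belong to facets containing [F]; conversely, any facet normal is constrained
    by a(T) and its neighbors. *)
Lemma normal_cone_face : normal_cone Q F = cone_face T S.
Proof.
apply/seteqP; split=> [_ [u hull_u <-]|x Sx]; last first.
  exists (x - center); last by rewrite addrC subrK.
  apply: conic_hullS (conic_hull_normals Sx) => _ [p [ep pS] <-].
  exists (maximizers Q (edge_normal R T p)); split.
  - exact: normal_facet.
  - exact: face_sub_facet.
  - by split=> //; apply: sum_normal.
(* The inequalities of [cone_face], translated to the origin. [K] is a convex cone, so the inclusion
   can be checked on the facet normals. *)
pose K := [set v : 'rV[R]_n | [/\ \sum_k v 0 k = 0,
  forall p, edge T p.1 p.2 -> 0 <= dotp v (edge_dir R p) &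
  forall p, edge T p.1 p.2 -> p \notin S -> dotp v (edge_dir R p) = 0]].
have [u0 u_ge u_off] : K u.
  apply: conic_hull_min hull_u.
  - split=> [|p _|p _ _]; rewrite ?[dotp 0 _]dotpC ?dotp0r //.
    by apply: big1 => k _; rewrite mxE.
  - move=> x y [x0 x_ge x_off] [y0 y_ge y_off]; split=> [|p ep|p ep pS].
    + by rewrite -[LHS]mul1r -dotp_const dotpDr !dotp_const x0 y0 mulr0 addr0.
    + by rewrite dotpDl addr_ge0 ?x_ge ?y_ge.
    + by rewrite dotpDl x_off ?y_off ?addr0.
  - move=> b x b_ge0 [x0 x_ge x_off]; split=> [|p ep|p ep pS].
    + by rewrite -[LHS]mul1r -dotp_const dotpZr dotp_const x0 !mulr0.
    + by rewrite dotpZl mulr_ge0 ?x_ge.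
    + by rewrite dotpZl x_off ?mulr0.
  move=> v [G [_ FG [v0 eqG]]]; have aG : maximizers Q v a.
    by rewrite -eqG; apply/FG/point_in_face.
  split=> // [p ep|p ep pS]; first exact: max_at_point.
  (* Off [S], [c] is orthogonal to u_p, so a(T) - u_p also lies in [F], hence in [G]; this bounds
     the value of [v] on u_p by 0. *)
  have [_] : maximizers Q v (a - edge_dir R p).
    rewrite -eqG; apply: FG; split; first exact: polyhedron_neighbor.
    by move=> y Qy; rewrite dotpBr c_off // subr0 point_in_face.2.
  move=> /(_ a (point_polyhedron R dT)); rewrite dotpBr lerBrDr gerDl => le0.
  by apply/eqP; rewrite eq_le le0 max_at_point.
have dir_u p : dotp (center + u) (edge_dir R p) = dotp u (edge_dir R p).
  by rewrite dotpDl dotp_center_dir add0r.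
split; last by move=> p ep pS; rewrite dir_u u_off.
apply/permutree_coneP; rewrite addrAC subrr add0r; split=> // p ep.
by rewrite dir_u u_ge.
Qed.

End Face.

End NormalCones.

Lemma normal_fan_polyhedron (R : realType) (n : nat) (delta : n.-tuple symbol) :
  normal_fan (permutree_polyhedron R delta) = permutree_fan R delta.
Proof.
apply/seteqP; split=> [_ [F [F_neq0 [c ->]] ->]|C [T dT /face_is_cone_face [S ->]]].
  have [T [dT cT]] := permutree_extension delta (c 0).
  (* [S] collects the edges along which [c] strictly increases, which locates [c] in the relative
     interior of a face of the cone. *)
  exists T => //; pose S := [set p | 0 < dotp c (edge_dir R p)]%SET.
  rewrite (@normal_cone_face _ _ _ _ dT S c); first exact: cone_face_is_face.
    by move=> p _; rewrite inE.
  move=> p ep; rewrite inE -leNgt => le0; apply/eqP; rewrite eq_le le0 dotp_dir subr_ge0.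
  exact: cT.
(* By duality of the bases, [c] takes the value 1 on the edges of [S] and 0 on the other edges. *)
pose c : 'rV[R]_n := \sum_(p | edge T p.1 p.2 && (p \in S)) edge_normal R T p.
have c_dir p : edge T p.1 p.2 -> dotp c (edge_dir R p) = (p \in S)%:R.
  move=> ep; rewrite dotp_suml; have [pS|pS] := boolP (p \in S).
    rewrite (bigD1 p) ?ep //= dotp_normal_dir // eqxx big1 ?addr0 //.
    by move=> q /andP [/andP [eq _] /negPf neq]; rewrite dotp_normal_dir // eq_sym neq.
  apply: big1 => q /andP [eq qS]; rewrite dotp_normal_dir //.
  by have [eq_pq|//] := eqVneq; rewrite eq_pq qS in pS.
have c_in p : edge T p.1 p.2 -> p \in S -> 0 < dotp c (edge_dir R p).
  by move=> ep pS; rewrite c_dir // pS.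
have c_off p : edge T p.1 p.2 -> p \notin S -> dotp c (edge_dir R p) = 0.
  by move=> ep /negPf pS; rewrite c_dir // pS.
exists (maximizers (permutree_polyhedron R delta) c).
  by split; [exists (permutree_point R T); apply: point_in_face c_in c_off|exists c].
by rewrite (normal_cone_face dT c_in c_off).
Qed.

Theorem theorem40 (R : realType) (n : nat) (delta : n.-tuple symbol) :
  [/\ permutree_hull R delta = permutree_polyhedron R delta,
      polytope (permutree_hull R delta) &
      normal_fan (permutree_hull R delta) = permutree_fan R delta].
Proof.
split; first exact: hull_polyhedron.
  exact: hull_polytope.
by rewrite hull_polyhedron normal_fan_polyhedron.
Qed.
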